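(* The product $\mathbb{H}\times\mathbb{R}^2_3$, with its product metric $d$ and product convexity mapping $W$, is a complete uniformly smooth $UCW$-hyperbolic space; that is, the metric space $(\mathbb{H}\times\mathbb{R}^2_3,d)$ is complete, $(\mathbb{H}\times\mathbb{R}^2_3,d,W)$ is a $UCW$-hyperbolic space, and there is a function $\pi$ such that $(\mathbb{H}\times\mathbb{R}^2_3,d,W,\pi)$ is a uniformly smooth hyperbolic space.
   Context: A $W$-hyperbolic space is a triple $(X,d,W)$ where $(X,d)$ is a metric space and $W:X^2\times[0,1]\to X$ is such that, for all $x,y,z,w\in X$ and $\lambda,\mu\in[0,1]$: (W1) $d(z,W(x,y,\lambda))\le(1-\lambda)d(z,x)+\lambda d(z,y)$; (W2) $d(W(x,y,\lambda),W(x,y,\mu))=|\lambda-\mu|d(x,y)$; (W3) $W(x,y,\lambda)=W(y,x,1-\lambda)$; (W4) $d(W(x,z,\lambda),W(y,w,\lambda))\le(1-\lambda)d(x,y)+\lambda d(z,w)$. One writes $\frac{x+y}{2}$ for $W(x,y,\frac12)$, and $d^2(x,y)$ for $(d(x,y))^2$. A modulus of uniform convexity for a $W$-hyperbolic space $(X,d,W)$ is a function $\eta:(0,\infty)\times(0,2]\to(0,1]$ such that, for any $r>0$, any $\varepsilon\in(0,2]$ and any $a,x,y\in X$ with $d(x,a)\le r$, $d(y,a)\le r$, $d(x,y)\ge\varepsilon r$, we have $d\left(\frac{x+y}{2},a\right)\le(1-\eta(r,\varepsilon))r$. It is monotone if, for any $r,s>0$ with $s\le r$ and any $\varepsilon\in(0,2]$,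 $\eta(r,\varepsilon)\le\eta(s,\varepsilon)$. A $UCW$-hyperbolic space is a $W$-hyperbolic space that admits a monotone modulus of uniform convexity. An ordered pair $(a,b)\in X^2$ is denoted by $\overrightarrow{ab}$. A smooth hyperbolic space is a quadruple $(X,d,W,\pi)$ where $(X,d,W)$ is a $W$-hyperbolic space and $\pi:X^2\times X^2\to\mathbb{R}$ is such that, for any $x,y,z,u,v\in X$ and $\lambda\in[0,1]$: (P1) $\pi(\overrightarrow{xy},\overrightarrow{xy})=d^2(x,y)$; (P2) $\pi(\overrightarrow{xy},\overrightarrow{uv})=-\pi(\overrightarrow{yx},\overrightarrow{uv})=-\pi(\overrightarrow{xy},\overrightarrow{vu})$; (P3) $\pi(\overrightarrow{xy},\overrightarrow{uv})+\pi(\overrightarrow{yz},\overrightarrow{uv})=\pi(\overrightarrow{xz},\overrightarrow{uv})$; (P4) $\pi(\overrightarrow{xy},\overrightarrow{uv})\le d(x,y)d(u,v)$; (P5) $d^2(W(x,y,\lambda),z)\le(1-\lambda)^2d^2(x,z)+2\lambda\,\pi(\overrightarrow{yz},\overrightarrow{W(x,y,\lambda)z})$. A uniformly smooth hyperbolic space is a smooth hyperbolic space $(X,d,W,\pi)$ for which there is a function $\omega:(0,\infty)\times(0,\infty)\to(0,\infty)$ such that, for any $r,\varepsilon>0$ and $a,u,v,x,y\in X$ with $d(u,a)\le r$, $d(v,a)\le r$ and $d(u,v)\le\omega(r,\varepsilon)$, one has $|\pi(\overrightarrow{xy},\overrightarrow{ua})-\pi(\overrightarrow{xy},\overrightarrow{va})|\le\varepsilon\cdot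 d(x,y)$. $\mathbb{H}:=\{(x_1,x_2)\in\mathbb{R}^2\mid x_2>0\}$ is the Poincaré upper half-plane with metric $d_{\mathbb{H}}(x,y):=\operatorname{arcosh}\left(1+\frac{(y_1-x_1)^2+(y_2-x_2)^2}{2x_2y_2}\right)$, where $\operatorname{arcosh}t=\ln(t+\sqrt{t^2-1})$ for $t\ge1$. For any $x,y\in\mathbb{H}$ there is a unique geodesic from $x$ to $y$, i.e. a unique $\gamma:[0,1]\to\mathbb{H}$ with $\gamma(0)=x$, $\gamma(1)=y$ and $d_{\mathbb{H}}(\gamma(t),\gamma(t'))=|t-t'|d_{\mathbb{H}}(x,y)$ for all $t,t'\in[0,1]$; put $W_{\mathbb{H}}(x,y,\lambda):=\gamma(\lambda)$. $\mathbb{R}^2_3$ is the plane $\mathbb{R}^2$ with the norm $\|(s,t)\|_3=(|s|^3+|t|^3)^{1/3}$, its induced metric $d_3$, and the canonical convexity mapping $W_3(p,q,\lambda)=(1-\lambda)p+\lambda q$. On $\mathbb{H}\times\mathbb{R}^2_3$: $d((x,p),(y,q)):=\left(d_{\mathbb{H}}^2(x,y)+d_3^2(p,q)\right)^{1/2}$ and $W((x,p),(y,q),\lambda):=(W_{\mathbb{H}}(x,y,\lambda),W_3(p,q,\lambda))$. *)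

(* Defs.v *)
From Stdlib Require Import Reals ClassicalEpsilon.
Open Scope R_scope.

(** * Metric and hyperbolic structures *)

Record is_metric (X : Type) (d : X -> X -> R) : Prop := {
  metric_nonneg : forall x y : X, 0 <= d x y;
  metric_eq0 : forall x y : X, d x y = 0 <-> x = y;
  metric_sym : forall x y : X, d x y = d y x;
  metric_triangle : forall x y z : X, d x z <= d x y + d y z
}.

Definition cauchy_seq (X : Type) (d : X -> X -> R) (u : nat -> X) : Prop :=
  forall eps : R, 0 < eps ->
    exists N : nat, forall m n : nat, (N <= m)%nat -> (N <= n)%nat ->
      d (u m) (u n) < eps.

Definition converges_to (X : Type) (d : X -> X -> R) (u : nat -> X) (l : X)
    : Prop :=
  forall eps : R, 0 < eps ->
    exists N : nat, forall n : nat, (N <= n)%nat -> d (u n) l < eps.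

Definition complete_metric_space (X : Type) (d : X -> X -> R) : Prop :=
  is_metric X d /\
  forall u : nat -> X, cauchy_seq X d u -> exists l : X, converges_to X d u l.

(** A convexity mapping [X^2 x [0,1] -> X] is represented by a function
    [W : X -> X -> R -> X]; every property below only uses its values at
    parameters in [0,1]. *)

Record W_hyperbolic (X : Type) (d : X -> X -> R) (W : X -> X -> R -> X)
    : Prop := {
  Whyp_metric : is_metric X d;
  Whyp_W1 : forall (x y z : X) (l : R), 0 <= l <= 1 ->
    d z (W x y l) <= (1 - l) * d z x + l * d z y;
  Whyp_W2 : forall (x y : X) (l m : R), 0 <= l <= 1 -> 0 <= m <= 1 ->
    d (W x y l) (W x y m) = Rabs (l - m) * d x y;
  Whyp_W3 : forall (x y : X) (l : R), 0 <= l <= 1 ->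
    W x y l = W y x (1 - l);
  Whyp_W4 : forall (x y z w : X) (l : R), 0 <= l <= 1 ->
    d (W x z l) (W y w l) <= (1 - l) * d x y + l * d z w
}.

(** [eta : (0,oo) x (0,2] -> (0,1]] is represented by a function on [R * R]
    whose values outside this domain are never used; the same convention is
    used for [omega] in [uniformly_smooth_hyperbolic]. *)
Definition modulus_of_uniform_convexity (X : Type) (d : X -> X -> R)
    (W : X -> X -> R -> X) (eta : R -> R -> R) : Prop :=
  (forall r eps : R, 0 < r -> 0 < eps <= 2 -> 0 < eta r eps <= 1) /\
  (forall (r eps : R) (a x y : X), 0 < r -> 0 < eps <= 2 ->
    d x a <= r -> d y a <= r -> d x y >= eps * r ->
    d (W x y (1 / 2)) a <= (1 - eta r eps) * r).

Definition monotone_modulus (eta : R -> R -> R) : Prop :=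
  forall r s eps : R, 0 < r -> 0 < s -> s <= r -> 0 < eps <= 2 ->
    eta r eps <= eta s eps.

Definition UCW_hyperbolic (X : Type) (d : X -> X -> R) (W : X -> X -> R -> X)
    : Prop :=
  W_hyperbolic X d W /\
  exists eta : R -> R -> R,
    modulus_of_uniform_convexity X d W eta /\ monotone_modulus eta.

Record smooth_hyperbolic (X : Type) (d : X -> X -> R) (W : X -> X -> R -> X)
    (pi : X * X -> X * X -> R) : Prop := {
  smooth_Whyp : W_hyperbolic X d W;
  smooth_P1 : forall x y : X, pi (x, y) (x, y) = (d x y) ^ 2;
  smooth_P2 : forall x y u v : X,
    pi (x, y) (u, v) = - pi (y, x) (u, v) /\
    pi (x, y) (u, v) = - pi (x, y) (v, u);
  smooth_P3 : forall x y z u v : X,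
    pi (x, y) (u, v) + pi (y, z) (u, v) = pi (x, z) (u, v);
  smooth_P4 : forall x y u v : X, pi (x, y) (u, v) <= d x y * d u v;
  smooth_P5 : forall (x y z : X) (l : R), 0 <= l <= 1 ->
    (d (W x y l) z) ^ 2 <=
      (1 - l) ^ 2 * (d x z) ^ 2 + 2 * l * pi (y, z) (W x y l, z)
}.

Definition uniformly_smooth_hyperbolic (X : Type) (d : X -> X -> R)
    (W : X -> X -> R -> X) (pi : X * X -> X * X -> R) : Prop :=
  smooth_hyperbolic X d W pi /\
  exists omega : R -> R -> R,
    (forall r eps : R, 0 < r -> 0 < eps -> 0 < omega r eps) /\
    (forall (r eps : R) (a u v x y : X), 0 < r -> 0 < eps ->
      d u a <= r -> d v a <= r -> d u v <= omega r eps ->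
      Rabs (pi (x, y) (u, a) - pi (x, y) (v, a)) <= eps * d x y).

(** * The Poincaré upper half-plane *)

Definition arcosh (t : R) : R := ln (t + sqrt (t ^ 2 - 1)).

Definition Hplane : Type := {x : R * R | 0 < snd x}.

Definition Hx1 (x : Hplane) : R := fst (proj1_sig x).
Definition Hx2 (x : Hplane) : R := snd (proj1_sig x).

Definition dH (x y : Hplane) : R :=
  arcosh (1 + ((Hx1 y - Hx1 x) ^ 2 + (Hx2 y - Hx2 x) ^ 2)
              / (2 * Hx2 x * Hx2 y)).

Definition is_geodesicH (x y : Hplane) (g : R -> Hplane) : Prop :=
  g 0 = x /\ g 1 = y /\
  forall t t' : R, 0 <= t <= 1 -> 0 <= t' <= 1 ->
    dH (g t) (g t') = Rabs (t - t') * dH x y.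

(** Geodesics of the half-plane exist and are unique on [0,1], so the choice
    operator returns, on [0,1], the geodesic from [x] to [y]; the constant
    function only witnesses that the type is inhabited. *)
Definition WH (x y : Hplane) (l : R) : Hplane :=
  epsilon (inhabits (fun _ : R => x)) (is_geodesicH x y) l.

(** * The plane with the 3-norm *)

(** [Rpower 0 (1 / 3)] is [1] in the standard library, hence the case
    distinction; only used for [0 <= x]. *)
Definition cbrt (x : R) : R :=
  if Rlt_dec 0 x then Rpower x (1 / 3) else 0.

Definition norm3 (p : R * R) : R :=
  cbrt (Rabs (fst p) ^ 3 + Rabs (snd p) ^ 3).

Definition d3 (p q : R * R) : R := norm3 (fst p - fst q, snd p - snd q).

Definition W3 (p q : R * R) (l : R) : R * R :=
  ((1 - l) * fst p + l * fst q, (1 - l) * snd p + l * snd q).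

(** * The product *)

Definition HR3 : Type := (Hplane * (R * R))%type.

Definition dHR3 (a b : HR3) : R :=
  sqrt ((dH (fst a) (fst b)) ^ 2 + (d3 (snd a) (snd b)) ^ 2).

Definition WHR3 (a b : HR3) (l : R) : HR3 :=
  (WH (fst a) (fst b) l, W3 (snd a) (snd b) l).

(* Main.v *)
Require Import Defs.
From Stdlib Require Import Reals Lra Lia Classical ClassicalEpsilon.
Open Scope R_scope.

(** Every part of the claim passes to l2-products (lemmas [l2dist_complete],
    [prodW_hyperbolic], [prod_uniformly_smooth], [prod_uniformly_convex]), so it
    is enough to treat the half-plane and the plane with the 3-norm separately.
    Uniform convexity is passed through the inequality [cubically_convex],
    which holds in both factors and bounds [d(m,a)^2] at a midpoint [m] by the
    mean of the two squared distances minus [d(x,y)^3 / (24 r)]; the product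
    then has the modulus [eps^3 / 384], independent of [r] and hence monotone.

    Half-plane.  All metric facts come from [coshdist x y], the hyperbolic
    cosine of the distance, which up to sign is the Lorentzian inner product
    of the points on the hyperboloid.  The Gram determinant of three points for
    [coshdist] is nonnegative ([coshdist_gram]), which gives a law of cosines
    with a factor in [-1,1], hence the triangle inequality.  Since
    [cosh (sqrt q)] is convex in [q], the third side is at least as long as in
    the Euclidean comparison triangle ([hyperbolic_cosine_comparison]).  Applied
    to the two triangles cut off at a point of the explicit geodesic [geodH],
    this gives the CAT(0) inequality ([geodH_CN]); it forces
    uniqueness of geodesics, so that [WH] agrees with [geodH] on [0,1] and
    satisfies the same inequality ([WH_CAT0]).  Along geodesics,
    the CAT(0) inequality implies the axioms of a W-hyperbolic space
    ([CAT0_W_hyperbolic]) and the Cauchy-Schwarz inequality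
    [CAT0_cauchy_schwarz] for the quasi-linearization, which serves as [pi].

    Plane.  Here [pi] pairs a vector with the image of another one under the
    normalized duality mapping [(s,t) |-> (s|s|, t|t|) / |(s,t)|_3].  (P4) is
    Hölder's inequality, (P5) the subgradient inequality for the squared norm,
    and uniform smoothness holds because both coordinates of the duality
    mapping are Lipschitz.  Cubical convexity comes from Clarkson's inequality
    for the exponent 3. *)

(** * Preliminaries *)

Lemma sqr_le_inv (a b : R) : 0 <= b -> a ^ 2 <= b ^ 2 -> a <= b.
Proof. intros Hb H. destruct (Rle_or_lt a b); nra. Qed.

Lemma cube_le_inv (a b : R) : 0 <= b -> a ^ 3 <= b ^ 3 -> a <= b.
Proof.
intros Hb H. destruct (Rle_or_lt a b) as [| Hlt]; trivial.
assert (0 < (a - b) * (a ^ 2 + a * b + b ^ 2)) by (apply Rmult_lt_0_compat; nra). nra.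
Qed.

Lemma metric_refl (X : Type) (d : X -> X -> R) (x : X) : is_metric X d -> d x x = 0.
Proof. intros M. now apply (metric_eq0 _ _ M). Qed.

Lemma nondecreasing_of_deriv (f f' : R -> R) (a b : R) :
  a <= b ->
  (forall c, a <= c <= b -> derivable_pt_lim f c (f' c)) ->
  (forall c, a <= c <= b -> 0 <= f' c) -> f a <= f b.
Proof.
intros [Hab | ->] Hd Hp; [| lra].
destruct (MVT_cor2 f f' a b Hab Hd) as [c [Hc Hc']].
assert (0 <= f' c) by (apply Hp; lra). nra.
Qed.

(** * Hyperbolic functions *)

Lemma cosh_sqr (a : R) : cosh a ^ 2 = sinh a ^ 2 + 1.
Proof.
unfold cosh, sinh. rewrite exp_Ropp. pose proof (exp_pos a). field. lra.
Qed.

Lemma cosh_plus (a b : R) : cosh (a + b) = cosh a * cosh b + sinh a * sinh b.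
Proof.
unfold cosh, sinh. rewrite !exp_Ropp, exp_plus.
pose proof (exp_pos a). pose proof (exp_pos b). field. lra.
Qed.

Lemma sinh_plus (a b : R) : sinh (a + b) = sinh a * cosh b + cosh a * sinh b.
Proof.
unfold cosh, sinh. rewrite !exp_Ropp, exp_plus.
pose proof (exp_pos a). pose proof (exp_pos b). field. lra.
Qed.

Lemma cosh_opp (a : R) : cosh (- a) = cosh a.
Proof. unfold cosh. rewrite Ropp_involutive. field. Qed.

Lemma sinh_opp (a : R) : sinh (- a) = - sinh a.
Proof. unfold sinh. rewrite Ropp_involutive. field. Qed.

Lemma cosh_abs (s : R) : cosh (Rabs s) = cosh s.
Proof. unfold Rabs. destruct (Rcase_abs s); [apply cosh_opp | easy]. Qed.

Lemma cosh_half (s : R) : cosh s = 1 + 2 * sinh (s / 2) ^ 2.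
Proof.
replace s with (s / 2 + s / 2) at 1 by field. rewrite cosh_plus.
pose proof (cosh_sqr (s / 2)). lra.
Qed.

Lemma sinh_plus_sqr (a b : R) :
  sinh (a + b) ^ 2 =
  sinh a ^ 2 + sinh b ^ 2 + 2 * sinh a * sinh b * cosh (a + b).
Proof.
rewrite sinh_plus, cosh_plus.
pose proof (cosh_sqr a) as Ha. pose proof (cosh_sqr b) as Hb.
transitivity (sinh a ^ 2 * cosh b ^ 2 + cosh a ^ 2 * sinh b ^ 2
              + 2 * sinh a * sinh b * cosh a * cosh b); [ring |].
rewrite Ha, Hb. ring.
Qed.

Lemma cosh_ge1 (a : R) : 1 <= cosh a.
Proof.
pose proof (cosh_sqr a). pose proof (exp_pos a). pose proof (exp_pos (- a)).
assert (0 < cosh a) by (unfold cosh; lra). nra.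
Qed.

Lemma sinh_pos (a : R) : 0 < a -> 0 < sinh a.
Proof.
intros Ha. unfold sinh. assert (exp (- a) < exp a) by (apply exp_increasing; lra).
lra.
Qed.

Lemma sinh_nonneg (a : R) : 0 <= a -> 0 <= sinh a.
Proof.
intros [Ha | <-]; [left; now apply sinh_pos | rewrite sinh_0; lra].
Qed.

Lemma cosh_increasing (a b : R) : 0 <= a -> a < b -> cosh a < cosh b.
Proof.
intros Ha Hab. replace b with (a + (b - a)) by ring. rewrite cosh_plus.
pose proof (cosh_ge1 a). pose proof (sinh_nonneg a Ha).
assert (0 < sinh (b - a)) by (apply sinh_pos; lra).
pose proof (cosh_sqr (b - a)). pose proof (cosh_ge1 (b - a)).
assert (1 < cosh (b - a)) by nra. nra.
Qed.

Lemma cosh_le_inv (a b : R) : 0 <= b -> cosh a <= cosh b -> a <= b.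
Proof.
intros Hb H. destruct (Rle_or_lt a b) as [|Hlt]; trivial.
pose proof (cosh_increasing b a Hb Hlt). lra.
Qed.

Lemma cosh_inj (a b : R) : 0 <= a -> 0 <= b -> cosh a = cosh b -> a = b.
Proof. intros Ha Hb H. apply Rle_antisym; apply cosh_le_inv; lra. Qed.

Lemma cosh_ln_sub (a b : R) : 0 < a -> 0 < b ->
  cosh (ln a - ln b) = (a ^ 2 + b ^ 2) / (2 * a * b).
Proof.
intros Ha Hb. unfold cosh.
replace (- (ln a - ln b)) with (ln b + - ln a) by ring.
unfold Rminus. rewrite !exp_plus, !exp_Ropp, !exp_ln by trivial. field. lra.
Qed.

Lemma arcosh_nonneg (t : R) : 1 <= t -> 0 <= arcosh t.
Proof.
intros Ht. unfold arcosh. rewrite <- ln_1. pose proof (sqrt_pos (t ^ 2 - 1)).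
destruct (Req_dec (t + sqrt (t ^ 2 - 1)) 1) as [-> |]; [lra |].
left. apply ln_increasing; lra.
Qed.

Lemma cosh_arcosh (t : R) : 1 <= t -> cosh (arcosh t) = t.
Proof.
intros Ht. unfold cosh, arcosh. pose proof (sqrt_pos (t ^ 2 - 1)).
assert (E : sqrt (t ^ 2 - 1) ^ 2 = t ^ 2 - 1) by (apply pow2_sqrt; nra).
set (s := sqrt (t ^ 2 - 1)) in *.
rewrite exp_Ropp, exp_ln by lra.
replace (/ (t + s)) with (t - s); [field |].
apply (Rmult_eq_reg_l (t + s)); [rewrite Rinv_r by lra; nra | lra].
Qed.

Lemma sinh_ge_id (t : R) : 0 <= t -> t <= sinh t.
Proof.
intros Ht.
assert (H : sinh 0 - 0 <= sinh t - t).
{ apply (nondecreasing_of_deriv (fun s => sinh s - s) (fun s => cosh s - 1)); trivial.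
  - intros c _. apply (derivable_pt_lim_minus sinh id).
    + apply derivable_pt_lim_sinh.
    + apply derivable_pt_lim_id.
  - intros c _. pose proof (cosh_ge1 c). lra. }
rewrite sinh_0 in H. lra.
Qed.

Lemma sinh_le_mul_cosh (t : R) : 0 <= t -> sinh t <= t * cosh t.
Proof.
intros Ht.
assert (H : 0 * cosh 0 - sinh 0 <= t * cosh t - sinh t).
{ apply (nondecreasing_of_deriv (fun s => s * cosh s - sinh s)
           (fun s => s * sinh s)); trivial.
  - intros c _. replace (c * sinh c) with (1 * cosh c + c * sinh c - cosh c) by ring.
    apply (derivable_pt_lim_minus (fun s => s * cosh s) sinh).
    + apply (derivable_pt_lim_mult id cosh).
      * apply derivable_pt_lim_id.
      * apply derivable_pt_lim_cosh.
    + apply derivable_pt_lim_sinh.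
  - intros c Hc. apply Rmult_le_pos; [lra | apply sinh_nonneg; lra]. }
rewrite sinh_0 in H. lra.
Qed.

(** The quotient [sinh s / s] is nondecreasing. *)
Lemma sinh_ratio_incr (t s : R) : 0 <= t -> t <= s -> s * sinh t <= t * sinh s.
Proof.
intros Ht Hs.
assert (H : t * sinh t - sinh t * t <= t * sinh s - sinh t * s).
{ apply (nondecreasing_of_deriv (fun s => t * sinh s - sinh t * s)
           (fun s => t * cosh s - sinh t)); trivial.
  - intros c _. replace (t * cosh c - sinh t) with (t * cosh c - sinh t * 1) by ring.
    apply (derivable_pt_lim_minus (fun s => t * sinh s) (fun s => sinh t * s)).
    + apply (derivable_pt_lim_scal sinh t), derivable_pt_lim_sinh.
    + apply (derivable_pt_lim_scal id (sinh t)), derivable_pt_lim_id.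
  - intros c Hc. pose proof (sinh_le_mul_cosh t Ht).
    assert (cosh t <= cosh c).
    { destruct (proj1 Hc) as [Hlt | ->]; [left; apply cosh_increasing; lra | lra]. }
    nra. }
lra.
Qed.

(** The graph of [q |-> cosh (sqrt q)] lies above its tangent at [q = t ^ 2]; the
    inequality is multiplied by [2 * t] so that it makes sense at [t = 0]. *)
Lemma cosh_sqr_tangent (t s : R) : 0 <= t -> 0 <= s ->
  2 * t * cosh t + sinh t * (s ^ 2 - t ^ 2) <= 2 * t * cosh s.
Proof.
intros Ht Hs.
assert (D : forall c, derivable_pt_lim (fun s => 2 * t * cosh s - sinh t * s ^ 2) c
                        (2 * t * sinh c - sinh t * (2 * c))).
{ intros c.
  apply (derivable_pt_lim_minus (fun s => 2 * t * cosh s) (fun s => sinh t * s ^ 2)).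
  - apply (derivable_pt_lim_scal cosh (2 * t)), derivable_pt_lim_cosh.
  - apply (derivable_pt_lim_scal (fun s => s ^ 2) (sinh t)).
    replace (2 * c) with (INR 2 * c ^ pred 2) by (simpl; ring).
    apply derivable_pt_lim_pow. }
destruct (Rle_or_lt t s) as [Hts | Hst].
- assert (H : 2 * t * cosh t - sinh t * t ^ 2 <= 2 * t * cosh s - sinh t * s ^ 2).
  { apply (nondecreasing_of_deriv _ _ t s Hts (fun c _ => D c)).
    intros c Hc. pose proof (sinh_ratio_incr t c). nra. }
  nra.
- assert (H : - (2 * t * cosh s - sinh t * s ^ 2) <= - (2 * t * cosh t - sinh t * t ^ 2)).
  { apply (nondecreasing_of_deriv (fun c => - (2 * t * cosh c - sinh t * c ^ 2))
             (fun c => - (2 * t * sinh c - sinh t * (2 * c)))); [lra | |].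
    - intros c _. apply (derivable_pt_lim_opp (fun s => 2 * t * cosh s - sinh t * s ^ 2)), D.
    - intros c Hc. pose proof (sinh_ratio_incr c t). nra. }
  nra.
Qed.

(** Convexity of [q |-> cosh (sqrt q)]. *)
Lemma cosh_sqr_convex (a b e th : R) : 0 <= a -> 0 <= b -> 0 <= e -> 0 <= th <= 1 ->
  e ^ 2 = (1 - th) * a ^ 2 + th * b ^ 2 ->
  cosh e <= (1 - th) * cosh a + th * cosh b.
Proof.
intros Ha Hb He Hth E.
destruct He as [He | <-].
- pose proof (cosh_sqr_tangent e a (Rlt_le _ _ He) Ha).
  pose proof (cosh_sqr_tangent e b (Rlt_le _ _ He) Hb).
  apply (Rmult_le_reg_l (2 * e)); [lra |].
  apply Rle_trans with ((1 - th) * (2 * e * cosh a) + th * (2 * e * cosh b)); [| lra].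
  apply Rle_trans with
    ((1 - th) * (2 * e * cosh e + sinh e * (a ^ 2 - e ^ 2)) +
     th * (2 * e * cosh e + sinh e * (b ^ 2 - e ^ 2))); [| nra].
  right. replace (e ^ 2) with ((1 - th) * a ^ 2 + th * b ^ 2). ring.
- rewrite cosh_0. pose proof (cosh_ge1 a). pose proof (cosh_ge1 b). nra.
Qed.

(** A side [c] of a hyperbolic triangle is at least as long as the corresponding
    side of the Euclidean triangle with the same two other sides and the same
    cosine [k] of the angle between them. For fixed [a] and [b], the hyperbolic
    cosine of the former and the square of the latter are affine in [k], and
    both triangles degenerate to the same segments at [k = 1] and [k = -1]. *)
Lemma hyperbolic_cosine_comparison (a b c k : R) :
  0 <= a -> 0 <= b -> 0 <= c -> -1 <= k <= 1 ->
  cosh c = cosh a * cosh b - k * (sinh a * sinh b) ->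
  a ^ 2 + b ^ 2 - 2 * k * (a * b) <= c ^ 2.
Proof.
intros Ha Hb Hc Hk E.
(* [q] is the squared Euclidean side: a convex combination of [(a - b) ^ 2] and
   [(a + b) ^ 2] with the weight [(1 - k) / 2] on the latter. *)
set (q := a ^ 2 + b ^ 2 - 2 * k * (a * b)).
assert (Hq : 0 <= q).
{ unfold q. assert (0 <= a * b) by (apply Rmult_le_pos; lra).
  assert (0 <= (a - b) ^ 2) by apply pow2_ge_0. nra. }
assert (Hs : sqrt q ^ 2 = q) by (apply pow2_sqrt; lra).
pose proof (sqrt_pos q) as Hs0.
assert (H : cosh (sqrt q) <=
  (1 - (1 - k) / 2) * cosh (Rabs (a - b)) + (1 - k) / 2 * cosh (a + b)).
{ apply cosh_sqr_convex; trivial; try lra.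
  - apply Rabs_pos.
  - rewrite Hs, <- !Rsqr_pow2, <- Rsqr_abs, !Rsqr_pow2. unfold q. field. }
assert (Hab : cosh (Rabs (a - b)) = cosh a * cosh b - sinh a * sinh b).
{ rewrite cosh_abs. unfold Rminus at 1. rewrite cosh_plus, cosh_opp, sinh_opp. ring. }
rewrite Hab, cosh_plus in H.
assert (sqrt q <= c) by (apply cosh_le_inv; lra).
rewrite <- Hs. nra.
Qed.

(** * The distance of the half-plane *)

(** The hyperbolic cosine of the distance. *)
Definition coshdist (x y : Hplane) : R :=
  ((Hx1 y - Hx1 x) ^ 2 + Hx2 x ^ 2 + Hx2 y ^ 2) / (2 * Hx2 x * Hx2 y).

Lemma Hx2_pos (x : Hplane) : 0 < Hx2 x.
Proof. exact (proj2_sig x). Qed.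

Lemma Hplane_ext (x y : Hplane) : Hx1 x = Hx1 y -> Hx2 x = Hx2 y -> x = y.
Proof.
destruct x as [[a b] p], y as [[c d] q]. cbn. intros -> ->.
f_equal. apply proof_irrelevance.
Qed.

Lemma coshdist_eq (x y : Hplane) :
  1 + ((Hx1 y - Hx1 x) ^ 2 + (Hx2 y - Hx2 x) ^ 2) / (2 * Hx2 x * Hx2 y) = coshdist x y.
Proof.
unfold coshdist. pose proof (Hx2_pos x). pose proof (Hx2_pos y). field. lra.
Qed.

Lemma coshdist_ge1 (x y : Hplane) : 1 <= coshdist x y.
Proof.
rewrite <- coshdist_eq. pose proof (Hx2_pos x). pose proof (Hx2_pos y).
assert (0 <= ((Hx1 y - Hx1 x) ^ 2 + (Hx2 y - Hx2 x) ^ 2) / (2 * Hx2 x * Hx2 y)); [| lra].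
apply Rle_mult_inv_pos.
- apply Rplus_le_le_0_compat; apply pow2_ge_0.
- repeat apply Rmult_lt_0_compat; lra.
Qed.

Lemma coshdist_sym (x y : Hplane) : coshdist x y = coshdist y x.
Proof.
unfold coshdist. pose proof (Hx2_pos x). pose proof (Hx2_pos y). field. lra.
Qed.

Lemma coshdist_eq1 (x y : Hplane) : coshdist x y = 1 -> x = y.
Proof.
rewrite <- coshdist_eq. pose proof (Hx2_pos x). pose proof (Hx2_pos y). intros E.
assert (E' : (Hx1 y - Hx1 x) ^ 2 + (Hx2 y - Hx2 x) ^ 2 = 0).
{ assert (E0 : forall n d, 0 < d -> 1 + n / d = 1 -> n = 0).
  { intros n d Hd En. replace n with (n / d * d) by (field; lra).
    replace (n / d) with 0 by lra. ring. }
  apply (E0 _ _) in E; trivial. repeat apply Rmult_lt_0_compat; lra. }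
rewrite <- !Rsqr_pow2 in E'. destruct (Rplus_sqr_eq_0 _ _ E').
apply Hplane_ext; lra.
Qed.

(** The hyperboloid point of [p] has the null coordinates [u p], [v p] and [w p]
    below, with [u p * v p - w p ^ 2 = 1]. The right side minus the left
    one is the Gram determinant of the three points for [coshdist], which is a
    quarter of the square of the determinant [D] of their coordinates. *)
Lemma coshdist_gram (x y z : Hplane) :
  (coshdist x z - coshdist x y * coshdist y z) ^ 2
  <= (coshdist x y ^ 2 - 1) * (coshdist y z ^ 2 - 1).
Proof.
set (u := fun p => / Hx2 p).
set (v := fun p => (Hx1 p ^ 2 + Hx2 p ^ 2) / Hx2 p).
set (w := fun p => Hx1 p / Hx2 p).
set (D := u x * (v y * w z - w y * v z) - v x * (u y * w z - w y * u z)
        + w x * (u y * v z - v y * u z)).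
assert (E : (coshdist x y ^ 2 - 1) * (coshdist y z ^ 2 - 1)
            - (coshdist x z - coshdist x y * coshdist y z) ^ 2 = (D / 2) ^ 2).
{ unfold D, u, v, w, coshdist.
  pose proof (Hx2_pos x). pose proof (Hx2_pos y). pose proof (Hx2_pos z).
  field. lra. }
pose proof (pow2_ge_0 (D / 2)). lra.
Qed.

Lemma dH_arcosh (x y : Hplane) : dH x y = arcosh (coshdist x y).
Proof. unfold dH. now rewrite coshdist_eq. Qed.

Lemma cosh_dH (x y : Hplane) : cosh (dH x y) = coshdist x y.
Proof. rewrite dH_arcosh. apply cosh_arcosh, coshdist_ge1. Qed.

Lemma dH_nonneg (x y : Hplane) : 0 <= dH x y.
Proof. rewrite dH_arcosh. apply arcosh_nonneg, coshdist_ge1. Qed.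

Lemma dH_sym (x y : Hplane) : dH x y = dH y x.
Proof. rewrite !dH_arcosh. now rewrite coshdist_sym. Qed.

(** When [y] is distinct from [x] and [z], [k] is the cosine of the angle at [y]. *)
Lemma dH_law_of_cosines (x y z : Hplane) :
  exists k, -1 <= k <= 1 /\
    cosh (dH x z) = cosh (dH x y) * cosh (dH y z) - k * (sinh (dH x y) * sinh (dH y z)).
Proof.
set (S := sinh (dH x y) * sinh (dH y z)).
set (C := cosh (dH x y) * cosh (dH y z) - cosh (dH x z)).
assert (H : C ^ 2 <= S ^ 2).
{ pose proof (coshdist_gram x y z) as H. rewrite <- !cosh_dH, !cosh_sqr in H.
  unfold C, S. lra. }
assert (HS : 0 <= S) by (apply Rmult_le_pos; apply sinh_nonneg, dH_nonneg).
destruct HS as [HS | HS].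
- exists (C / S). assert (E : C / S * S = C) by (field; lra). split.
  + assert (C <= S) by nra. assert (- S <= C) by nra.
    split; apply (Rmult_le_reg_r S); lra.
  + rewrite E. unfold C. ring.
- exists 0. split; [lra |]. assert (C = 0) by nra. unfold C in *. lra.
Qed.

Lemma dH_triangle (x y z : Hplane) : dH x z <= dH x y + dH y z.
Proof.
pose proof (dH_nonneg x y) as Hxy. pose proof (dH_nonneg y z) as Hyz.
apply cosh_le_inv; [lra |]. rewrite cosh_plus.
destruct (dH_law_of_cosines x y z) as [k [Hk ->]].
pose proof (Rmult_le_pos _ _ (sinh_nonneg _ Hxy) (sinh_nonneg _ Hyz)). nra.
Qed.

Lemma dH_refl (x : Hplane) : dH x x = 0.
Proof.
apply cosh_inj; [apply dH_nonneg | lra |]. rewrite cosh_dH, cosh_0.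
unfold coshdist. pose proof (Hx2_pos x). field. lra.
Qed.

Lemma dH_metric : is_metric Hplane dH.
Proof.
split.
- exact dH_nonneg.
- intros x y. split; [| intros ->; apply dH_refl].
  intros H. apply coshdist_eq1. now rewrite <- cosh_dH, H, cosh_0.
- exact dH_sym.
- exact dH_triangle.
Qed.

(** * Geodesics of the half-plane *)

(** The point with coordinates [(a, b)] for [b > 0]. Writing [b] as [exp (ln b)]
    makes the second coordinate positive for every [b]. *)
Definition Hpoint (a b : R) : Hplane := exist _ (a, exp (ln b)) (exp_pos (ln b)).

Lemma Hx1_Hpoint (a b : R) : Hx1 (Hpoint a b) = a.
Proof. reflexivity. Qed.

Lemma Hx2_Hpoint (a b : R) : 0 < b -> Hx2 (Hpoint a b) = b.
Proof. exact (exp_ln b). Qed.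

(** The geodesic from [x] to [y], for [x <> y]. On the hyperboloid it is the
    combination of the two endpoints with the coefficients [a] and [b]; the point
    with null coordinates [u], [v], [w] is [(w / u, 1 / u)] in the half-plane. *)
Definition geodH (x y : Hplane) (l : R) : Hplane :=
  let D := dH x y in
  let a := sinh ((1 - l) * D) / sinh D in
  let b := sinh (l * D) / sinh D in
  let u := a / Hx2 x + b / Hx2 y in
  Hpoint ((a * Hx1 x / Hx2 x + b * Hx1 y / Hx2 y) / u) (/ u).

(** Up to sign, [coshdist] is the Lorentzian inner product of hyperboloid points,
    hence affine in each of them; the hypothesis on [a] and [b] says that the
    combination of [x] and [y] lies on the hyperboloid. *)
Lemma coshdist_combination (x y z : Hplane) (a b : R) :
  0 <= a -> 0 <= b -> a ^ 2 + b ^ 2 + 2 * a * b * coshdist x y = 1 ->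
  let u := a / Hx2 x + b / Hx2 y in
  coshdist (Hpoint ((a * Hx1 x / Hx2 x + b * Hx1 y / Hx2 y) / u) (/ u)) z
  = a * coshdist x z + b * coshdist y z.
Proof.
intros Ha Hb E u.
pose proof (Hx2_pos x). pose proof (Hx2_pos y). pose proof (Hx2_pos z).
assert (Hu : 0 < u).
{ assert (0 < / Hx2 x) by (apply Rinv_0_lt_compat; lra).
  assert (0 < / Hx2 y) by (apply Rinv_0_lt_compat; lra).
  unfold u, Rdiv. destruct Ha as [Ha | <-]; [nra |].
  assert (0 < b) by nra. nra. }
set (w := a * Hx1 x / Hx2 x + b * Hx1 y / Hx2 y).
set (v := a * (Hx1 x ^ 2 + Hx2 x ^ 2) / Hx2 x + b * (Hx1 y ^ 2 + Hx2 y ^ 2) / Hx2 y).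
assert (Huv : u * v - w ^ 2 = 1).
{ rewrite <- E. unfold u, v, w, coshdist. field. lra. }
unfold coshdist at 1. rewrite Hx1_Hpoint, Hx2_Hpoint by now apply Rinv_0_lt_compat.
fold w.
transitivity ((u * (Hx1 z ^ 2 + Hx2 z ^ 2) - 2 * w * Hx1 z + v) / (2 * Hx2 z)).
- replace v with ((1 + w ^ 2) / u) by (rewrite <- Huv; field; lra). field. lra.
- unfold u, v, w, coshdist. field. lra.
Qed.

(** The hyperbolic form of Stewart's theorem. *)
Lemma stewart_geodH (x y z : Hplane) (l : R) : 0 < dH x y -> 0 <= l <= 1 ->
  coshdist (geodH x y l) z * sinh (dH x y) =
  sinh ((1 - l) * dH x y) * coshdist x z + sinh (l * dH x y) * coshdist y z.
Proof.
intros HD Hl. unfold geodH. set (D := dH x y) in *.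
pose proof (sinh_pos D HD) as HS.
rewrite coshdist_combination.
- field. lra.
- apply Rle_mult_inv_pos; trivial. apply sinh_nonneg. nra.
- apply Rle_mult_inv_pos; trivial. apply sinh_nonneg. nra.
- rewrite <- cosh_dH. fold D.
  pose proof (sinh_plus_sqr ((1 - l) * D) (l * D)) as H.
  replace ((1 - l) * D + l * D) with D in H by ring.
  apply (Rmult_eq_reg_r (sinh D ^ 2)); [| apply pow_nonzero; lra].
  rewrite Rmult_1_l. etransitivity; [| symmetry; exact H]. field. lra.
Qed.

Lemma geodH_is_geodesic (x y : Hplane) : 0 < dH x y -> is_geodesicH x y (geodH x y).
Proof.
intros HD. pose proof (sinh_pos _ HD) as HS.
assert (L : forall l, 0 <= l <= 1 -> forall m, 0 <= m <= 1 ->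
  dH (geodH x y l) (geodH x y m) = Rabs (l - m) * dH x y).
{ intros l Hl m Hm. apply cosh_inj.
  - apply dH_nonneg.
  - apply Rmult_le_pos; [apply Rabs_pos | lra].
  - apply (Rmult_eq_reg_r (sinh (dH x y))); [| lra].
    rewrite cosh_dH, stewart_geodH by trivial.
    rewrite (coshdist_sym x), (coshdist_sym y).
    apply (Rmult_eq_reg_r (sinh (dH x y))); [| lra].
    transitivity (sinh ((1 - l) * dH x y) * (coshdist (geodH x y m) x * sinh (dH x y))
      + sinh (l * dH x y) * (coshdist (geodH x y m) y * sinh (dH x y))); [ring |].
    rewrite !stewart_geodH by trivial. rewrite (coshdist_sym y x), <- !cosh_dH, !dH_refl, cosh_0.
    replace (cosh (Rabs (l - m) * dH x y)) with (cosh ((l - m) * dH x y)).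
    2:{ unfold Rabs. destruct (Rcase_abs (l - m)); trivial.
        rewrite <- cosh_opp. f_equal. ring. }
    set (D := dH x y) in *.
    replace ((1 - l) * D) with (D + - (l * D)) by ring.
    replace ((1 - m) * D) with (D + - (m * D)) by ring.
    replace ((l - m) * D) with (l * D + - (m * D)) by ring.
    rewrite !sinh_plus, !cosh_plus, !sinh_opp, !cosh_opp.
    ring_simplify. rewrite (cosh_sqr D). ring. }
assert (S : forall l z, 0 <= l <= 1 -> sinh ((1 - l) * dH x y) * coshdist x z +
   sinh (l * dH x y) * coshdist y z = sinh (dH x y) -> geodH x y l = z).
{ intros l z Hl H. apply coshdist_eq1. apply (Rmult_eq_reg_r (sinh (dH x y))); [| lra].
  rewrite stewart_geodH by trivial. lra. }
split; [| split].
- apply S; [lra |]. rewrite <- (cosh_dH x x), dH_refl, cosh_0, Rmult_0_l, sinh_0.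
  replace ((1 - 0) * dH x y) with (dH x y) by ring. ring.
- apply S; [lra |]. rewrite <- (cosh_dH y y), dH_refl, cosh_0.
  replace ((1 - 1) * dH x y) with 0 by ring. rewrite sinh_0, Rmult_1_l. ring.
- intros l m Hl Hm. now apply L.
Qed.

(** The CAT(0) inequality along the explicit geodesic: the law of cosines is
    compared with the Euclidean one in the two triangles that the point [w] of
    the geodesic forms with [z] and one of the endpoints; their angles at [w]
    are supplementary. *)
Lemma geodH_CN (x y z : Hplane) (l : R) : 0 < dH x y -> 0 <= l <= 1 ->
  dH (geodH x y l) z ^ 2 <=
  (1 - l) * dH x z ^ 2 + l * dH y z ^ 2 - l * (1 - l) * dH x y ^ 2.
Proof.
intros HD Hl. destruct (geodH_is_geodesic x y HD) as [G0 [G1 G]].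
destruct (Req_dec l 0) as [-> | Hl0]; [rewrite G0; lra |].
pose proof (stewart_geodH x y z l HD Hl) as St.
set (w := geodH x y l) in *. set (D := dH x y) in *.
assert (Hxw : dH w x = l * D).
{ rewrite <- G0. unfold w. rewrite G by lra. rewrite Rabs_right by lra. fold D. ring. }
assert (Hwy : dH w y = (1 - l) * D).
{ rewrite <- G1. unfold w. rewrite G by lra. rewrite Rabs_left1 by lra. fold D. ring. }
assert (Hp : 0 < sinh (l * D)) by (apply sinh_pos; nra).
destruct (dH_law_of_cosines x w z) as [k [Hk E]].
rewrite (dH_sym x w), Hxw in E. rewrite <- !cosh_dH in St.
set (p := l * D) in *. set (q := (1 - l) * D) in *.
assert (E' : cosh (dH y z) = cosh q * cosh (dH w z) - (- k) * (sinh q * sinh (dH w z))).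
{ apply (Rmult_eq_reg_l (sinh p)); [| lra].
  replace (sinh D) with (sinh (q + p)) in St by (f_equal; unfold p, q; ring).
  rewrite E, sinh_plus in St.
  pose proof (cosh_sqr p) as Cp.
  replace (sinh p * cosh (dH y z)) with
    (cosh (dH w z) * (sinh q * cosh p + cosh q * sinh p) -
     sinh q * (cosh p * cosh (dH w z) - k * (sinh p * sinh (dH w z)))) by lra.
  ring. }
assert (0 <= p) by (unfold p; nra). assert (0 <= q) by (unfold q; nra).
apply hyperbolic_cosine_comparison in E, E'; try apply dH_nonneg; try lra.
assert (H1 : (1 - l) * (p ^ 2 + dH w z ^ 2 - 2 * k * (p * dH w z)) <= (1 - l) * dH x z ^ 2)
  by (apply Rmult_le_compat_l; lra).
assert (H2 : l * (q ^ 2 + dH w z ^ 2 - 2 * - k * (q * dH w z)) <= l * dH y z ^ 2)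
  by (apply Rmult_le_compat_l; lra).
unfold p, q in *. lra.
Qed.

Lemma WH_geodesic (x y : Hplane) : is_geodesicH x y (WH x y).
Proof.
apply (epsilon_spec (inhabits (fun _ : R => x)) (is_geodesicH x y)).
destruct (dH_nonneg x y) as [HD | HD]; [eexists; now apply geodH_is_geodesic |].
exists (fun _ => x). split; [easy | split].
- apply dH_metric. easy.
- intros l m _ _. rewrite dH_refl, <- HD. ring.
Qed.

(** * Completeness of the half-plane *)

Lemma dH_ge_ln (x y : Hplane) : Rabs (ln (Hx2 x) - ln (Hx2 y)) <= dH x y.
Proof.
pose proof (Hx2_pos x). pose proof (Hx2_pos y).
apply cosh_le_inv; [apply dH_nonneg |].
rewrite cosh_abs, cosh_dH, cosh_ln_sub by trivial. unfold coshdist.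
apply Rmult_le_compat_r; [| pose proof (pow2_ge_0 (Hx1 y - Hx1 x)); lra].
left. apply Rinv_0_lt_compat. repeat apply Rmult_lt_0_compat; lra.
Qed.

(** Horizontal displacement is controlled by the distance on sets where the
    second coordinate is bounded. *)
Lemma dH_ge_horizontal (x y : Hplane) (B : R) :
  Hx2 x <= B -> Hx2 y <= B -> dH x y <= 2 ->
  Rabs (Hx1 x - Hx1 y) <= B * cosh 1 * dH x y.
Proof.
intros Hx Hy Hd. pose proof (Hx2_pos x). pose proof (Hx2_pos y).
pose proof (dH_nonneg x y). pose proof (cosh_ge1 1).
assert (HB : 0 <= B * cosh 1) by nra.
apply sqr_le_inv; [now apply Rmult_le_pos |]. rewrite pow2_abs.
assert (E : (Hx1 x - Hx1 y) ^ 2 + (Hx2 y - Hx2 x) ^ 2 =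
  4 * (Hx2 x * Hx2 y) * sinh (dH x y / 2) ^ 2).
{ pose proof (cosh_dH x y) as E. rewrite cosh_half, <- coshdist_eq in E.
  apply Rplus_eq_reg_l in E.
  transitivity (2 * Hx2 x * Hx2 y * (2 * sinh (dH x y / 2) ^ 2)); [| ring].
  rewrite E. field. lra. }
assert (S : sinh (dH x y / 2) <= dH x y / 2 * cosh 1).
{ eapply Rle_trans; [apply sinh_le_mul_cosh; lra |]. apply Rmult_le_compat_l; [lra |].
  destruct (Req_dec (dH x y / 2) 1) as [-> |]; [lra |].
  left. apply cosh_increasing; lra. }
assert (S2 : sinh (dH x y / 2) ^ 2 <= (dH x y / 2 * cosh 1) ^ 2).
{ apply pow_incr. split; [apply sinh_nonneg; lra | easy]. }
pose proof (pow2_ge_0 (Hx2 y - Hx2 x)). pose proof (pow2_ge_0 (sinh (dH x y / 2))).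
assert (Hx2 x * Hx2 y <= B * B) by (apply Rmult_le_compat; lra).
apply Rle_trans with (4 * (B * B) * (dH x y / 2 * cosh 1) ^ 2); [| right; field].
apply Rle_trans with (4 * (Hx2 x * Hx2 y) * sinh (dH x y / 2) ^ 2); [lra |].
apply Rmult_le_compat; nra.
Qed.

(** The distance is bounded by the length of a path with a horizontal part at
    the height of [y] and a vertical part. *)
Lemma dH_le (x y : Hplane) :
  dH x y <= Rabs (Hx1 x - Hx1 y) / Hx2 y + Rabs (ln (Hx2 x) - ln (Hx2 y)).
Proof.
pose proof (Hx2_pos x) as Px. pose proof (Hx2_pos y) as Py.
(* The corner of the path. *)
set (m := Hpoint (Hx1 x) (Hx2 y)).
assert (m1 : Hx1 m = Hx1 x) by apply Hx1_Hpoint.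
assert (m2 : Hx2 m = Hx2 y) by now apply Hx2_Hpoint.
assert (V : dH x m <= Rabs (ln (Hx2 x) - ln (Hx2 y))).
{ apply cosh_le_inv; [apply Rabs_pos |].
  rewrite cosh_abs, cosh_dH, cosh_ln_sub by trivial.
  unfold coshdist. rewrite m1, m2. right. field. lra. }
assert (K : dH m y <= Rabs (Hx1 x - Hx1 y) / Hx2 y).
{ set (s := Rabs (Hx1 x - Hx1 y) / Hx2 y).
  assert (Hs : 0 <= s) by (apply Rle_mult_inv_pos; [apply Rabs_pos | easy]).
  apply cosh_le_inv; trivial. rewrite cosh_dH, cosh_half.
  assert ((s / 2) ^ 2 <= sinh (s / 2) ^ 2)
    by (apply pow_incr; split; [lra | apply sinh_ge_id; lra]).
  assert (E : coshdist m y = 1 + 2 * (s / 2) ^ 2); [| lra].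
  unfold coshdist. rewrite m1, m2.
  replace ((s / 2) ^ 2) with ((Hx1 x - Hx1 y) ^ 2 / (4 * Hx2 y ^ 2)).
  - field. lra.
  - unfold s. rewrite <- (pow2_abs (Hx1 x - Hx1 y)). field. lra. }
pose proof (dH_triangle x m y). lra.
Qed.

Lemma dH_complete : complete_metric_space Hplane dH.
Proof.
split; [exact dH_metric |]. intros u Hu.
destruct (R_complete (fun n => ln (Hx2 (u n)))) as [L HL].
{ intros eps He. destruct (Hu eps He) as [N HN]. exists N. intros n m Hn Hm.
  eapply Rle_lt_trans; [apply dH_ge_ln | exact (HN n m Hn Hm)]. }
destruct (HL 1 ltac:(lra)) as [N0 HN0]. unfold Rdist in HN0.
set (B := exp (L + 1)).
assert (HB : forall n, (N0 <= n)%nat -> Hx2 (u n) <= B).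
{ intros n Hn. rewrite <- (exp_ln (Hx2 (u n))) by apply Hx2_pos.
  left. apply exp_increasing. specialize (HN0 n Hn). apply Rabs_def2 in HN0. lra. }
assert (PB : 0 < B * cosh 1).
{ apply Rmult_lt_0_compat; [apply exp_pos |]. pose proof (cosh_ge1 1). lra. }
destruct (R_complete (fun n => Hx1 (u n))) as [X HX].
{ intros eps He.
  destruct (Hu (Rmin 2 (eps / (B * cosh 1)))) as [N HN].
  { apply Rmin_glb_lt; [lra | now apply Rdiv_lt_0_compat]. }
  exists (Nat.max N N0). intros n m Hn Hm. specialize (HN n m ltac:(lia) ltac:(lia)).
  pose proof (Rmin_l 2 (eps / (B * cosh 1))). pose proof (Rmin_r 2 (eps / (B * cosh 1))).
  pose proof (dH_ge_horizontal (u n) (u m) B (HB n ltac:(lia)) (HB m ltac:(lia)) ltac:(lra)).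
  apply Rle_lt_trans with (B * cosh 1 * dH (u n) (u m)); trivial.
  apply Rlt_le_trans with (B * cosh 1 * (eps / (B * cosh 1))).
  2:{ right. field. pose proof (cosh_ge1 1). pose proof (exp_pos (L + 1)). unfold B. lra. }
  apply Rmult_lt_compat_l; lra. }
exists (Hpoint X (exp L)). intros eps He. pose proof (exp_pos L) as PL.
destruct (HX (eps / 2 * exp L)) as [N1 HN1]; [nra |].
destruct (HL (eps / 2)) as [N2 HN2]; [lra |].
exists (Nat.max N1 N2). intros n Hn.
specialize (HN1 n ltac:(lia)). specialize (HN2 n ltac:(lia)). unfold Rdist in *.
eapply Rle_lt_trans; [apply dH_le |].
rewrite Hx1_Hpoint, Hx2_Hpoint, ln_exp by trivial.
assert (Rabs (Hx1 (u n) - X) / exp L < eps / 2); [| lra].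
apply (Rmult_lt_reg_r (exp L)); trivial.
unfold Rdiv at 1. rewrite Rmult_assoc, Rinv_l by lra. lra.
Qed.

(** * Convexity mappings satisfying the CAT(0) inequality *)

(** A convexity mapping whose segments are geodesics along which the squared
    distance to any point satisfies the CAT(0) inequality. *)
Record CAT0_convexity (X : Type) (d : X -> X -> R) (W : X -> X -> R -> X) : Prop := {
  CAT0_metric : is_metric X d;
  CAT0_W2 : forall (x y : X) (l m : R), 0 <= l <= 1 -> 0 <= m <= 1 ->
    d (W x y l) (W x y m) = Rabs (l - m) * d x y;
  CAT0_CN : forall (x y z : X) (l : R), 0 <= l <= 1 ->
    d (W x y l) z ^ 2 <= (1 - l) * d x z ^ 2 + l * d y z ^ 2 - l * (1 - l) * d x y ^ 2
}.

Lemma WH_CAT0 : CAT0_convexity Hplane dH WH.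
Proof.
split; [exact dH_metric | intros x y l m Hl Hm; now apply WH_geodesic |].
intros x y z l Hl.
destruct (WH_geodesic x y) as [G0 [G1 G]].
assert (Hx : dH x (WH x y l) = l * dH x y).
{ rewrite <- G0 at 1. rewrite G, Rabs_left1 by lra. ring. }
assert (Hy : dH y (WH x y l) = (1 - l) * dH x y).
{ rewrite <- G1 at 1. rewrite G, Rabs_right by lra. ring. }
destruct (dH_nonneg x y) as [HD | HD].
- (* The point [WH x y l] itself is tested in the CAT(0) inequality for [geodH]. *)
  assert (E : geodH x y l = WH x y l).
  { apply dH_metric. pose proof (geodH_CN x y (WH x y l) l HD Hl) as H.
    rewrite Hx, Hy in H. pose proof (dH_nonneg (geodH x y l) (WH x y l)). nra. }
  rewrite <- E. now apply geodH_CN.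
- rewrite <- HD in *. rewrite Rmult_0_r in Hx.
  apply dH_metric in Hx. symmetry in HD. apply dH_metric in HD. subst y.
  rewrite <- Hx. lra.
Qed.

Lemma CAT0_dist_l (X : Type) (d : X -> X -> R) (W : X -> X -> R -> X) (x y : X) (l : R) :
  CAT0_convexity X d W -> 0 <= l <= 1 -> d x (W x y l) = l * d x y.
Proof.
intros C Hl. pose proof (CAT0_metric _ _ _ C) as M.
pose proof (metric_nonneg _ _ M x y).
assert (d (W x y l) x <= l * d x y).
{ apply sqr_le_inv; [nra |]. pose proof (CAT0_CN _ _ _ C x y x l Hl) as H1.
  rewrite (metric_refl _ _ _ M), (metric_sym _ _ M y x) in H1. lra. }
assert (d (W x y l) y <= (1 - l) * d x y).
{ apply sqr_le_inv; [nra |]. pose proof (CAT0_CN _ _ _ C x y y l Hl) as H1.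
  rewrite (metric_refl _ _ _ M) in H1. lra. }
pose proof (metric_triangle _ _ M x (W x y l) y).
rewrite (metric_sym _ _ M x (W x y l)) in *. lra.
Qed.

Lemma CAT0_dist_r (X : Type) (d : X -> X -> R) (W : X -> X -> R -> X) (x y : X) (l : R) :
  CAT0_convexity X d W -> 0 <= l <= 1 -> d y (W x y l) = (1 - l) * d x y.
Proof.
intros C Hl. pose proof (CAT0_metric _ _ _ C) as M.
pose proof (metric_nonneg _ _ M x y).
assert (d y (W x y l) <= (1 - l) * d x y).
{ apply sqr_le_inv; [nra |]. pose proof (CAT0_CN _ _ _ C x y y l Hl) as H1.
  rewrite (metric_refl _ _ _ M), (metric_sym _ _ M (W x y l)) in H1. lra. }
pose proof (metric_triangle _ _ M x (W x y l) y).
rewrite (CAT0_dist_l _ _ _ _ _ _ C Hl), (metric_sym _ _ M (W x y l)) in *. lra.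
Qed.

(** A point that divides the distance from [x] to [y] in the same ratio as
    [W x y l] is equal to it. *)
Lemma CAT0_unique (X : Type) (d : X -> X -> R) (W : X -> X -> R -> X) (x y p : X) (l : R) :
  CAT0_convexity X d W -> 0 <= l <= 1 ->
  d x p = l * d x y -> d y p = (1 - l) * d x y -> W x y l = p.
Proof.
intros C Hl Hx Hy. pose proof (CAT0_metric _ _ _ C) as M.
apply (metric_eq0 _ _ M). pose proof (CAT0_CN _ _ _ C x y p l Hl) as H.
rewrite Hx, Hy in H. pose proof (metric_nonneg _ _ M (W x y l) p). nra.
Qed.

Lemma CAT0_W3 (X : Type) (d : X -> X -> R) (W : X -> X -> R -> X) (x y : X) (l : R) :
  CAT0_convexity X d W -> 0 <= l <= 1 -> W x y l = W y x (1 - l).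
Proof.
intros C Hl. pose proof (CAT0_metric _ _ _ C) as M.
apply (CAT0_unique _ _ _ _ _ _ _ C Hl).
- rewrite (CAT0_dist_r _ _ _ _ _ _ C), (metric_sym _ _ M y x) by lra. ring.
- rewrite (CAT0_dist_l _ _ _ _ _ _ C), (metric_sym _ _ M y x) by lra. ring.
Qed.

Lemma CAT0_W_common_endpoint (X : Type) (d : X -> X -> R) (W : X -> X -> R -> X)
  (x z w : X) (l : R) :
  CAT0_convexity X d W -> 0 <= l <= 1 -> d (W x z l) (W x w l) <= l * d z w.
Proof.
intros C Hl. pose proof (CAT0_metric _ _ _ C) as M.
pose proof (metric_nonneg _ _ M z w).
apply sqr_le_inv; [nra |].
pose proof (CAT0_CN _ _ _ C x z (W x w l) l Hl) as H1.
pose proof (CAT0_CN _ _ _ C x w z l Hl) as H2.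
rewrite (CAT0_dist_l _ _ _ _ _ _ C Hl), (metric_sym _ _ M z) in H1.
rewrite (metric_sym _ _ M w z) in H2. nra.
Qed.

(** (W4) is obtained by passing through the point [W x w l], which shares an
    endpoint with each of the two segments; (W1) is (W4) with a constant segment. *)
Lemma CAT0_W_hyperbolic (X : Type) (d : X -> X -> R) (W : X -> X -> R -> X) :
  CAT0_convexity X d W -> W_hyperbolic X d W.
Proof.
intros C. pose proof (CAT0_metric _ _ _ C) as M.
assert (W4 : forall (x y z w : X) (l : R), 0 <= l <= 1 ->
    d (W x z l) (W y w l) <= (1 - l) * d x y + l * d z w).
{ intros x y z w l Hl.
  pose proof (metric_triangle _ _ M (W x z l) (W x w l) (W y w l)).
  pose proof (CAT0_W_common_endpoint _ _ _ x z w l C Hl).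
  pose proof (CAT0_W_common_endpoint _ _ _ w x y (1 - l) C ltac:(lra)) as H1.
  rewrite (CAT0_W3 _ _ _ x w l C Hl), (CAT0_W3 _ _ _ y w l C Hl) in *. lra. }
split; trivial.
- intros x y z l Hl. pose proof (W4 z x z y l Hl) as H.
  replace (W z z l) with z in H; trivial.
  symmetry. apply (CAT0_unique _ _ _ _ _ _ _ C Hl); rewrite (metric_refl _ _ _ M); ring.
- exact (CAT0_W2 _ _ _ C).
- intros x y l Hl. now apply (CAT0_W3 _ _ _ _ _ _ C).
Qed.

(** The quasi-linearization of Berg and Nikolaev; in a Euclidean space it is the
    inner product of the vectors from [fst a] to [snd a] and from [fst b] to
    [snd b]. *)
Definition quasilinearization (X : Type) (d : X -> X -> R) (a b : X * X) : R :=
  (d (fst a) (snd b) ^ 2 + d (snd a) (fst b) ^ 2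
   - d (fst a) (fst b) ^ 2 - d (snd a) (snd b) ^ 2) / 2.

Lemma CAT0_cauchy_schwarz (X : Type) (d : X -> X -> R) (W : X -> X -> R -> X)
  (x y u v : X) :
  CAT0_convexity X d W -> quasilinearization X d (x, y) (u, v) <= d x y * d u v.
Proof.
intros C. pose proof (CAT0_metric _ _ _ C) as M. unfold quasilinearization. cbn [fst snd].
pose proof (metric_nonneg _ _ M x y) as Hxy. pose proof (metric_nonneg _ _ M u v) as Huv.
destruct Hxy as [Hxy | Hxy].
2:{ rewrite <- Hxy. symmetry in Hxy. apply (metric_eq0 _ _ M) in Hxy. subst y. lra. }
destruct Huv as [Huv | Huv].
2:{ rewrite <- Huv. symmetry in Huv. apply (metric_eq0 _ _ M) in Huv. subst v. lra. }
set (a := d x y) in *. set (b := d u v) in *.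
(* The point [m] on the diagonal [x v] is chosen so that the weights
   [(1 - l) / l] of [d x y ^ 2] and [l / (1 - l)] of [d u v ^ 2] in the resulting
   bound are [b / a] and [a / b], which makes both terms equal to [a * b]. *)
set (l := a / (a + b)).
assert (El : l * (a + b) = a) by (unfold l; field; lra).
assert (Hl : 0 < l < 1).
{ split; apply (Rmult_lt_reg_r (a + b)); lra. }
set (m := W x v l).
pose proof (CAT0_CN _ _ _ C x v y l ltac:(lra)) as H1.
pose proof (CAT0_CN _ _ _ C x v u l ltac:(lra)) as H2.
fold m in H1, H2. fold a in H1. rewrite (metric_sym _ _ M v u) in H2. fold b in H2.
pose proof (metric_triangle _ _ M y m u) as H3. rewrite (metric_sym _ _ M y m) in H3.
rewrite (metric_sym _ _ M v y) in H1.
pose proof (metric_nonneg _ _ M m y). pose proof (metric_nonneg _ _ M m u).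
pose proof (metric_nonneg _ _ M y u).
set (p := d m y) in *. set (q := d m u) in *. set (e := d x v) in *.
assert (K4 : l * (1 - l) * d y u ^ 2 <= (1 - l) * p ^ 2 + l * q ^ 2).
{ apply Rle_trans with (l * (1 - l) * (p + q) ^ 2).
  - apply Rmult_le_compat_l; [nra |]. apply pow_incr. lra.
  - pose proof (pow2_ge_0 ((1 - l) * p - l * q)). lra. }
assert (K5 : (1 - l) ^ 2 * a ^ 2 + l ^ 2 * b ^ 2 = 2 * (l * (1 - l)) * (a * b)).
{ assert (E : (1 - l) * a - l * b = 0) by lra.
  transitivity (((1 - l) * a - l * b) ^ 2 + 2 * (l * (1 - l)) * (a * b)); [ring |].
  rewrite E. ring. }
assert (K6 : (1 - l) * p ^ 2 <=
  (1 - l) * ((1 - l) * a ^ 2 + l * d y v ^ 2 - l * (1 - l) * e ^ 2))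
  by (apply Rmult_le_compat_l; lra).
assert (K7 : l * q ^ 2 <=
  l * ((1 - l) * d x u ^ 2 + l * b ^ 2 - l * (1 - l) * e ^ 2))
  by (apply Rmult_le_compat_l; lra).
apply (Rmult_le_reg_l (2 * (l * (1 - l)))); [nra |].
lra.
Qed.

Lemma CAT0_uniformly_smooth (X : Type) (d : X -> X -> R) (W : X -> X -> R -> X) :
  CAT0_convexity X d W -> uniformly_smooth_hyperbolic X d W (quasilinearization X d).
Proof.
intros C. pose proof (CAT0_metric _ _ _ C) as M. split.
- split.
  + now apply CAT0_W_hyperbolic.
  + intros x y. unfold quasilinearization. cbn [fst snd].
    rewrite !(metric_refl _ _ _ M), (metric_sym _ _ M y x). field.
  + intros x y u v. unfold quasilinearization. cbn [fst snd]. split; field.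
  + intros x y z u v. unfold quasilinearization. cbn [fst snd]. field.
  + intros x y u v. now apply (CAT0_cauchy_schwarz _ _ W).
  + intros x y z l Hl. unfold quasilinearization. cbn [fst snd].
    rewrite (CAT0_dist_r _ _ _ _ _ _ C Hl), (metric_refl _ _ _ M), (metric_sym _ _ M z).
    pose proof (CAT0_CN _ _ _ C x y z l Hl) as H.
    assert (0 <= l * l * d y z ^ 2) by (apply Rmult_le_pos; [nra | apply pow2_ge_0]).
    assert (H1 : (1 - l) * d (W x y l) z ^ 2 <= (1 - l) *
      ((1 - l) * d x z ^ 2 + l * d y z ^ 2 - l * (1 - l) * d x y ^ 2))
      by (apply Rmult_le_compat_l; lra).
    lra.
- exists (fun _ eps => eps). split; [easy |].
  intros r eps a u v x y Hr He _ _ Huv.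
  assert (E : quasilinearization X d (x, y) (u, a) - quasilinearization X d (x, y) (v, a)
    = quasilinearization X d (x, y) (u, v))
    by (unfold quasilinearization; cbn [fst snd]; field).
  assert (E' : - quasilinearization X d (x, y) (u, v) = quasilinearization X d (y, x) (u, v))
    by (unfold quasilinearization; cbn [fst snd]; field).
  rewrite E. pose proof (CAT0_cauchy_schwarz _ _ _ x y u v C) as H1.
  pose proof (CAT0_cauchy_schwarz _ _ _ y x u v C) as H2.
  rewrite (metric_sym _ _ M y x) in H2. pose proof (metric_nonneg _ _ M x y).
  apply Rabs_le. nra.
Qed.

(** A quantitative form of uniform convexity that is satisfied by both factors
    and passes to l2-products. *)
Definition cubically_convex (X : Type) (d : X -> X -> R) (W : X -> X -> R -> X) : Prop :=
  forall (r : R) (a x y : X), 0 < r -> d x a <= r -> d y a <= r ->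
    d (W x y (1 / 2)) a ^ 2 <= (d x a ^ 2 + d y a ^ 2) / 2 - d x y ^ 3 / (24 * r).

Lemma CAT0_cubically_convex (X : Type) (d : X -> X -> R) (W : X -> X -> R -> X) :
  CAT0_convexity X d W -> cubically_convex X d W.
Proof.
intros C r a x y Hr Hx Hy. pose proof (CAT0_metric _ _ _ C) as M.
pose proof (CAT0_CN _ _ _ C x y a (1 / 2) ltac:(lra)) as H.
pose proof (metric_triangle _ _ M x a y) as T. rewrite (metric_sym _ _ M a y) in T.
pose proof (metric_nonneg _ _ M x y).
assert (d x y ^ 3 / (24 * r) <= d x y ^ 2 / 4); [| lra].
apply (Rmult_le_reg_r (24 * r)); [lra |].
replace (d x y ^ 3 / (24 * r) * (24 * r)) with (d x y * d x y ^ 2) by (field; lra).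
pose proof (pow2_ge_0 (d x y)). nra.
Qed.

(** * Products *)

(** The l2-product of two distances. *)
Definition l2dist (X Y : Type) (d : X -> X -> R) (e : Y -> Y -> R) (a b : X * Y) : R :=
  sqrt (d (fst a) (fst b) ^ 2 + e (snd a) (snd b) ^ 2).

Definition prodW (X Y : Type) (W : X -> X -> R -> X) (V : Y -> Y -> R -> Y)
  (a b : X * Y) (l : R) : X * Y := (W (fst a) (fst b) l, V (snd a) (snd b) l).

Lemma l2_sqr (a b : R) : sqrt (a ^ 2 + b ^ 2) ^ 2 = a ^ 2 + b ^ 2.
Proof. apply pow2_sqrt. nra. Qed.

Lemma l2_cauchy_schwarz (a b c d : R) :
  a * c + b * d <= sqrt (a ^ 2 + b ^ 2) * sqrt (c ^ 2 + d ^ 2).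
Proof.
apply sqr_le_inv; [apply Rmult_le_pos; apply sqrt_pos |].
rewrite Rpow_mult_distr, !l2_sqr. pose proof (pow2_ge_0 (a * d - b * c)). lra.
Qed.

Lemma l2_mono (a b c d : R) : 0 <= a <= c -> 0 <= b <= d ->
  sqrt (a ^ 2 + b ^ 2) <= sqrt (c ^ 2 + d ^ 2).
Proof. intros. apply sqrt_le_1_alt, Rplus_le_compat; apply pow_incr; lra. Qed.

Lemma l2_minkowski (a b c d : R) :
  sqrt ((a + c) ^ 2 + (b + d) ^ 2) <= sqrt (a ^ 2 + b ^ 2) + sqrt (c ^ 2 + d ^ 2).
Proof.
pose proof (sqrt_pos (a ^ 2 + b ^ 2)). pose proof (sqrt_pos (c ^ 2 + d ^ 2)).
apply sqr_le_inv; [lra |]. rewrite l2_sqr.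
pose proof (l2_cauchy_schwarz a b c d). pose proof (l2_sqr a b). pose proof (l2_sqr c d).
nra.
Qed.

Lemma l2_scal (k a b : R) : 0 <= k ->
  sqrt ((k * a) ^ 2 + (k * b) ^ 2) = k * sqrt (a ^ 2 + b ^ 2).
Proof.
intros Hk. replace ((k * a) ^ 2 + (k * b) ^ 2) with (k ^ 2 * (a ^ 2 + b ^ 2)) by ring.
rewrite sqrt_mult, sqrt_pow2; nra.
Qed.

Lemma l2_convex (k l a b c d : R) : 0 <= k -> 0 <= l ->
  sqrt ((k * a + l * c) ^ 2 + (k * b + l * d) ^ 2)
  <= k * sqrt (a ^ 2 + b ^ 2) + l * sqrt (c ^ 2 + d ^ 2).
Proof.
intros Hk Hl. rewrite <- (l2_scal k), <- (l2_scal l) by trivial. apply l2_minkowski.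
Qed.

Lemma l2_ge_l (a b : R) : a <= sqrt (a ^ 2 + b ^ 2).
Proof. apply sqr_le_inv; [apply sqrt_pos |]. rewrite l2_sqr. nra. Qed.

Lemma l2_ge_r (a b : R) : b <= sqrt (a ^ 2 + b ^ 2).
Proof. rewrite Rplus_comm. apply l2_ge_l. Qed.

Lemma l2_le_sum (a b : R) : 0 <= a -> 0 <= b -> sqrt (a ^ 2 + b ^ 2) <= a + b.
Proof. intros. apply sqr_le_inv; [lra |]. rewrite l2_sqr. nra. Qed.

Lemma l2dist_metric (X Y : Type) (d : X -> X -> R) (e : Y -> Y -> R) :
  is_metric X d -> is_metric Y e -> is_metric (X * Y) (l2dist X Y d e).
Proof.
intros M N. unfold l2dist. split.
- intros. apply sqrt_pos.
- intros [x p] [y q]. cbn [fst snd]. split.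
  + intros H. pose proof (l2_ge_l (d x y) (e p q)). pose proof (l2_ge_r (d x y) (e p q)).
    pose proof (metric_nonneg _ _ M x y). pose proof (metric_nonneg _ _ N p q).
    f_equal; [apply (metric_eq0 _ _ M) | apply (metric_eq0 _ _ N)]; lra.
  + intros [= -> ->]. rewrite (metric_refl _ _ _ M), (metric_refl _ _ _ N).
    replace (0 ^ 2 + 0 ^ 2) with 0 by ring. apply sqrt_0.
- intros [x p] [y q]. cbn [fst snd]. now rewrite (metric_sym _ _ M x), (metric_sym _ _ N p).
- intros [x p] [y q] [z r]. cbn [fst snd].
  eapply Rle_trans; [| apply l2_minkowski]. apply l2_mono; split;
  first [apply (metric_nonneg _ _ M) | apply (metric_nonneg _ _ N)
        | apply (metric_triangle _ _ M) | apply (metric_triangle _ _ N)].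
Qed.

Lemma l2dist_complete (X Y : Type) (d : X -> X -> R) (e : Y -> Y -> R) :
  complete_metric_space X d -> complete_metric_space Y e ->
  complete_metric_space (X * Y) (l2dist X Y d e).
Proof.
intros [M CX] [N CY]. split; [now apply l2dist_metric |].
intros u Hu.
destruct (CX (fun n => fst (u n))) as [x Hx].
{ intros eps He. destruct (Hu eps He) as [K HK]. exists K. intros m n Hm Hn.
  eapply Rle_lt_trans; [apply l2_ge_l | exact (HK m n Hm Hn)]. }
destruct (CY (fun n => snd (u n))) as [y Hy].
{ intros eps He. destruct (Hu eps He) as [K HK]. exists K. intros m n Hm Hn.
  eapply Rle_lt_trans; [apply l2_ge_r | exact (HK m n Hm Hn)]. }
exists (x, y). intros eps He.
destruct (Hx (eps / 2)) as [K1 HK1]; [lra |].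
destruct (Hy (eps / 2)) as [K2 HK2]; [lra |].
exists (Nat.max K1 K2). intros n Hn.
specialize (HK1 n ltac:(lia)). specialize (HK2 n ltac:(lia)).
unfold l2dist. cbn [fst snd].
eapply Rle_lt_trans; [apply l2_le_sum |].
- apply (metric_nonneg _ _ M).
- apply (metric_nonneg _ _ N).
- lra.
Qed.

Lemma prodW_hyperbolic (X Y : Type) (d : X -> X -> R) (e : Y -> Y -> R)
  (W : X -> X -> R -> X) (V : Y -> Y -> R -> Y) :
  W_hyperbolic X d W -> W_hyperbolic Y e V ->
  W_hyperbolic (X * Y) (l2dist X Y d e) (prodW X Y W V).
Proof.
intros HX HY. pose proof (Whyp_metric _ _ _ HX) as M. pose proof (Whyp_metric _ _ _ HY) as N.
unfold l2dist, prodW. split.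
- now apply l2dist_metric.
- intros [x p] [y q] [z r] l Hl. cbn [fst snd].
  eapply Rle_trans; [| apply l2_convex; lra]. apply l2_mono; split;
  first [apply (metric_nonneg _ _ M) | apply (metric_nonneg _ _ N)
        | now apply (Whyp_W1 _ _ _ HX) | now apply (Whyp_W1 _ _ _ HY)].
- intros [x p] [y q] l m Hl Hm. cbn [fst snd].
  rewrite (Whyp_W2 _ _ _ HX), (Whyp_W2 _ _ _ HY) by trivial.
  apply l2_scal, Rabs_pos.
- intros [x p] [y q] l Hl. cbn [fst snd].
  now rewrite (Whyp_W3 _ _ _ HX), (Whyp_W3 _ _ _ HY) by trivial.
- intros [x p] [y q] [z r] [w s] l Hl. cbn [fst snd].
  eapply Rle_trans; [| apply l2_convex; lra]. apply l2_mono; split;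
  first [apply (metric_nonneg _ _ M) | apply (metric_nonneg _ _ N)
        | now apply (Whyp_W4 _ _ _ HX) | now apply (Whyp_W4 _ _ _ HY)].
Qed.

(** The sum of the two pairings of the factors. *)
Definition prodpi (X Y : Type) (p : X * X -> X * X -> R) (q : Y * Y -> Y * Y -> R)
  (a b : (X * Y) * (X * Y)) : R :=
  p (fst (fst a), fst (snd a)) (fst (fst b), fst (snd b))
  + q (snd (fst a), snd (snd a)) (snd (fst b), snd (snd b)).

Lemma prod_uniformly_smooth (X Y : Type) (d : X -> X -> R) (e : Y -> Y -> R)
  (W : X -> X -> R -> X) (V : Y -> Y -> R -> Y)
  (p : X * X -> X * X -> R) (q : Y * Y -> Y * Y -> R) :
  uniformly_smooth_hyperbolic X d W p -> uniformly_smooth_hyperbolic Y e V q ->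
  uniformly_smooth_hyperbolic (X * Y) (l2dist X Y d e) (prodW X Y W V) (prodpi X Y p q).
Proof.
intros [HX [o [Ho UX]]] [HY [o' [Ho' UY]]]. split.
- split.
  + apply prodW_hyperbolic; [apply (smooth_Whyp _ _ _ _ HX) | apply (smooth_Whyp _ _ _ _ HY)].
  + intros [x x'] [y y']. unfold prodpi, l2dist. cbn [fst snd].
    now rewrite l2_sqr, (smooth_P1 _ _ _ _ HX), (smooth_P1 _ _ _ _ HY).
  + intros [x x'] [y y'] [u u'] [v v']. unfold prodpi. cbn [fst snd].
    destruct (smooth_P2 _ _ _ _ HX x y u v). destruct (smooth_P2 _ _ _ _ HY x' y' u' v').
    lra.
  + intros [x x'] [y y'] [z z'] [u u'] [v v']. unfold prodpi. cbn [fst snd].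
    pose proof (smooth_P3 _ _ _ _ HX x y z u v).
    pose proof (smooth_P3 _ _ _ _ HY x' y' z' u' v'). lra.
  + intros [x x'] [y y'] [u u'] [v v']. unfold prodpi, l2dist. cbn [fst snd].
    eapply Rle_trans; [| apply l2_cauchy_schwarz].
    apply Rplus_le_compat; [apply (smooth_P4 _ _ _ _ HX) | apply (smooth_P4 _ _ _ _ HY)].
  + intros [x x'] [y y'] [z z'] l Hl. unfold prodpi, l2dist, prodW. cbn [fst snd].
    rewrite !l2_sqr.
    pose proof (smooth_P5 _ _ _ _ HX x y z l Hl).
    pose proof (smooth_P5 _ _ _ _ HY x' y' z' l Hl). lra.
- exists (fun r eps => Rmin (o r (eps / 2)) (o' r (eps / 2))). split.
  + intros r eps Hr He. apply Rmin_glb_lt; [apply Ho | apply Ho']; lra.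
  + intros r eps [a a'] [u u'] [v v'] [x x'] [y y'] Hr He Hu Hv Huv.
    unfold prodpi, l2dist in *. cbn [fst snd] in *.
    pose proof (Rmin_l (o r (eps / 2)) (o' r (eps / 2))).
    pose proof (Rmin_r (o r (eps / 2)) (o' r (eps / 2))).
    pose proof (l2_ge_l (d u a) (e u' a')). pose proof (l2_ge_r (d u a) (e u' a')).
    pose proof (l2_ge_l (d v a) (e v' a')). pose proof (l2_ge_r (d v a) (e v' a')).
    pose proof (l2_ge_l (d u v) (e u' v')). pose proof (l2_ge_r (d u v) (e u' v')).
    pose proof (l2_ge_l (d x y) (e x' y')). pose proof (l2_ge_r (d x y) (e x' y')).
    pose proof (UX r (eps / 2) a u v x y) as SX.
    pose proof (UY r (eps / 2) a' u' v' x' y') as SY.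
    match goal with |- Rabs ?t <= _ => replace t with
      ((p (x, y) (u, a) - p (x, y) (v, a)) + (q (x', y') (u', a') - q (x', y') (v', a')))
      by ring end.
    eapply Rle_trans; [apply Rabs_triang |].
    apply Rle_trans with (eps / 2 * d x y + eps / 2 * e x' y').
    * apply Rplus_le_compat; [apply SX | apply SY]; lra.
    * nra.
Qed.

Lemma prod_uniformly_convex (X Y : Type) (d : X -> X -> R) (e : Y -> Y -> R)
  (W : X -> X -> R -> X) (V : Y -> Y -> R -> Y) :
  is_metric X d -> is_metric Y e ->
  cubically_convex X d W -> cubically_convex Y e V ->
  modulus_of_uniform_convexity (X * Y) (l2dist X Y d e) (prodW X Y W V)
    (fun _ eps => eps ^ 3 / 384).
Proof.
intros M N HX HY.
assert (Heta : forall eps, 0 < eps <= 2 -> 0 < eps ^ 3 / 384 <= 1).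
{ intros eps He. assert (0 < eps ^ 3) by (apply pow_lt; lra).
  assert (eps ^ 3 <= 2 ^ 3) by (apply pow_incr; lra). lra. }
split; [intros r eps _; apply Heta |].
intros r eps [a a'] [x x'] [y y'] Hr He. unfold l2dist, prodW. cbn [fst snd].
intros Hx Hy Hxy. specialize (Heta eps He).
assert (Bx : d x a ^ 2 + e x' a' ^ 2 <= r ^ 2).
{ rewrite <- l2_sqr. apply pow_incr. split; [apply sqrt_pos | easy]. }
assert (By : d y a ^ 2 + e y' a' ^ 2 <= r ^ 2).
{ rewrite <- l2_sqr. apply pow_incr. split; [apply sqrt_pos | easy]. }
pose proof (l2_ge_l (d x a) (e x' a')). pose proof (l2_ge_r (d x a) (e x' a')).
pose proof (l2_ge_l (d y a) (e y' a')). pose proof (l2_ge_r (d y a) (e y' a')).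
pose proof (HX r a x y Hr ltac:(lra) ltac:(lra)) as CX.
pose proof (HY r a' x' y' Hr ltac:(lra) ltac:(lra)) as CY.
pose proof (metric_nonneg _ _ M x y). pose proof (metric_nonneg _ _ N x' y').
apply sqr_le_inv; [apply Rmult_le_pos; lra |]. rewrite l2_sqr.
(* One of the two factor distances is at least [eps * r / 2]. *)
assert (K : (eps * r) ^ 3 / 8 <= d x y ^ 3 + e x' y' ^ 3).
{ pose proof (l2_le_sum (d x y) (e x' y')).
  assert (0 <= eps * r) by nra.
  assert (0 <= d x y ^ 3) by (apply pow_le; lra).
  assert (0 <= e x' y' ^ 3) by (apply pow_le; lra).
  replace ((eps * r) ^ 3 / 8) with ((eps * r / 2) ^ 3) by field.
  destruct (Rle_or_lt (eps * r / 2) (d x y)).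
  - assert ((eps * r / 2) ^ 3 <= d x y ^ 3) by (apply pow_incr; lra). lra.
  - assert ((eps * r / 2) ^ 3 <= e x' y' ^ 3) by (apply pow_incr; lra). lra. }
assert (K' : eps ^ 3 / 192 * r ^ 2 <= d x y ^ 3 / (24 * r) + e x' y' ^ 3 / (24 * r)).
{ replace (eps ^ 3 / 192 * r ^ 2) with ((eps * r) ^ 3 / 8 / (24 * r)) by (field; lra).
  rewrite <- Rdiv_plus_distr. apply Rmult_le_compat_r; trivial.
  left. apply Rinv_0_lt_compat. lra. }
set (t := eps ^ 3 / 384) in *. replace (eps ^ 3 / 192) with (2 * t) in K' by (unfold t; field).
assert (0 <= t ^ 2 * r ^ 2) by (apply Rmult_le_pos; apply pow2_ge_0).
lra.
Qed.

(** * The 3-norm *)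

Lemma cbrt_nonneg (x : R) : 0 <= cbrt x.
Proof. unfold cbrt. destruct (Rlt_dec 0 x); [left; apply exp_pos | lra]. Qed.

Lemma cbrt_cube (x : R) : 0 <= x -> cbrt x ^ 3 = x.
Proof.
intros Hx. unfold cbrt. destruct (Rlt_dec 0 x) as [H |]; [| nra].
rewrite <- Rpower_pow by apply exp_pos. rewrite Rpower_mult.
replace (1 / 3 * INR 3) with 1 by (simpl; field). now apply Rpower_1.
Qed.

Lemma norm3_nonneg (p : R * R) : 0 <= norm3 p.
Proof. apply cbrt_nonneg. Qed.

Lemma norm3_cube (p : R * R) : norm3 p ^ 3 = Rabs (fst p) ^ 3 + Rabs (snd p) ^ 3.
Proof.
apply cbrt_cube. apply Rplus_le_le_0_compat; apply pow_le, Rabs_pos.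
Qed.

Lemma norm3_unique (p : R * R) (c : R) :
  0 <= c -> c ^ 3 = Rabs (fst p) ^ 3 + Rabs (snd p) ^ 3 -> norm3 p = c.
Proof.
intros Hc E. rewrite <- norm3_cube in E.
apply Rle_antisym; apply cube_le_inv; trivial; try apply norm3_nonneg; lra.
Qed.

Lemma norm3_ge_fst (p : R * R) : Rabs (fst p) <= norm3 p.
Proof.
apply cube_le_inv; [apply norm3_nonneg |]. rewrite norm3_cube.
pose proof (pow_le _ 3 (Rabs_pos (snd p))). lra.
Qed.

Lemma norm3_ge_snd (p : R * R) : Rabs (snd p) <= norm3 p.
Proof.
apply cube_le_inv; [apply norm3_nonneg |]. rewrite norm3_cube.
pose proof (pow_le _ 3 (Rabs_pos (fst p))). lra.
Qed.

Lemma norm3_le_sum (p : R * R) : norm3 p <= Rabs (fst p) + Rabs (snd p).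
Proof.
pose proof (Rabs_pos (fst p)). pose proof (Rabs_pos (snd p)).
apply cube_le_inv; [lra |]. rewrite norm3_cube.
assert (0 <= Rabs (fst p) * Rabs (snd p) * (Rabs (fst p) + Rabs (snd p)))
  by (repeat apply Rmult_le_pos; lra). lra.
Qed.

Lemma norm3_scal (k : R) (p : R * R) : norm3 (k * fst p, k * snd p) = Rabs k * norm3 p.
Proof.
apply norm3_unique; [apply Rmult_le_pos; [apply Rabs_pos | apply norm3_nonneg] |].
cbn [fst snd]. rewrite !Rabs_mult, Rpow_mult_distr, norm3_cube. ring.
Qed.

Lemma norm3_opp (p : R * R) : norm3 (- fst p, - snd p) = norm3 p.
Proof. unfold norm3. cbn [fst snd]. now rewrite !Rabs_Ropp. Qed.

Lemma norm3_eq0 (p : R * R) : norm3 p = 0 -> fst p = 0 /\ snd p = 0.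
Proof.
intros E. pose proof (norm3_ge_fst p) as H1. pose proof (norm3_ge_snd p) as H2.
rewrite E in *. split; apply NNPP; intros H; apply Rabs_pos_lt in H; lra.
Qed.

(** Hölder's inequality with exponents 3 and 3/2. *)
Lemma norm3_holder (p q : R * R) :
  Rabs (fst p) * Rabs (fst q) ^ 2 + Rabs (snd p) * Rabs (snd q) ^ 2
  <= norm3 p * norm3 q ^ 2.
Proof.
assert (Z : forall q, norm3 q = 0 -> Rabs (fst q) = 0 /\ Rabs (snd q) = 0).
{ intros q' E. apply norm3_eq0 in E. destruct E as [-> ->]. now rewrite Rabs_R0. }
pose proof (norm3_cube p) as Ep. pose proof (norm3_cube q) as Eq.
destruct (norm3_nonneg p) as [HX | E].
2:{ destruct (Z p (eq_sym E)) as [-> ->]. rewrite <- E. lra. }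
destruct (norm3_nonneg q) as [HY | E].
2:{ destruct (Z q (eq_sym E)) as [-> ->]. rewrite <- E. lra. }
pose proof (Rabs_pos (fst p)) as Ha. pose proof (Rabs_pos (snd p)) as Hb.
pose proof (Rabs_pos (fst q)) as Hc. pose proof (Rabs_pos (snd q)) as Hd.
set (X := norm3 p) in *. set (Y := norm3 q) in *.
set (a := Rabs (fst p)) in *. set (b := Rabs (snd p)) in *.
set (c := Rabs (fst q)) in *. set (d := Rabs (snd q)) in *.
(* Young's inequality is applied to vectors rescaled to the same norm [X * Y]. *)
assert (Young : forall u v, 0 <= u -> 0 <= v -> 3 * (u * v ^ 2) <= u ^ 3 + 2 * v ^ 3).
{ intros u v Hu Hv.
  assert (0 <= (u - v) ^ 2 * (u + 2 * v)) by (apply Rmult_le_pos; [apply pow2_ge_0 | lra]).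
  lra. }
pose proof (Young (a * Y) (c * X) ltac:(nra) ltac:(nra)) as H1.
pose proof (Young (b * Y) (d * X) ltac:(nra) ltac:(nra)) as H2.
assert (H3 : Y ^ 3 * X ^ 3 = Y ^ 3 * (a ^ 3 + b ^ 3)) by now rewrite Ep.
assert (H4 : X ^ 3 * Y ^ 3 = X ^ 3 * (c ^ 3 + d ^ 3)) by now rewrite Eq.
apply (Rmult_le_reg_l (3 * (Y * X ^ 2))); [| lra].
apply Rmult_lt_0_compat; [lra | apply Rmult_lt_0_compat; [lra | now apply pow_lt]].
Qed.

Lemma norm3_triangle (p q : R * R) :
  norm3 (fst p + fst q, snd p + snd q) <= norm3 p + norm3 q.
Proof.
set (s := (fst p + fst q, snd p + snd q)).
pose proof (norm3_nonneg p). pose proof (norm3_nonneg q).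
destruct (norm3_nonneg s) as [Hs | <-]; [| lra].
pose proof (norm3_cube s) as E.
pose proof (norm3_holder p s) as Hp. pose proof (norm3_holder q s) as Hq.
pose proof (Rabs_triang (fst p) (fst q)) as T1. pose proof (Rabs_triang (snd p) (snd q)) as T2.
change (fst p + fst q) with (fst s) in T1. change (snd p + snd q) with (snd s) in T2.
pose proof (pow2_ge_0 (Rabs (fst s))). pose proof (pow2_ge_0 (Rabs (snd s))).
apply (Rmult_le_reg_r (norm3 s ^ 2)); [now apply pow_lt |].
replace (norm3 s * norm3 s ^ 2) with (norm3 s ^ 3) by ring. rewrite E.
apply (Rmult_le_compat_r (Rabs (fst s) ^ 2)) in T1; trivial.
apply (Rmult_le_compat_r (Rabs (snd s) ^ 2)) in T2; trivial.
lra.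
Qed.

Definition sub2 (p q : R * R) : R * R := (fst p - fst q, snd p - snd q).

Lemma d3_norm3 (p q : R * R) : d3 p q = norm3 (sub2 p q).
Proof. reflexivity. Qed.

Lemma d3_metric : is_metric (R * R) d3.
Proof.
split.
- intros p q. apply norm3_nonneg.
- intros [s t] [s' t']. unfold d3. cbn [fst snd]. split.
  + intros H. apply norm3_eq0 in H. cbn [fst snd] in H. f_equal; lra.
  + intros [= -> ->]. apply norm3_unique; [lra |]. cbn [fst snd].
    rewrite !Rminus_diag, Rabs_R0. ring.
- intros p q. unfold d3. rewrite <- norm3_opp. cbn [fst snd].
  do 2 f_equal; ring.
- intros p q r. unfold d3. eapply Rle_trans; [| apply norm3_triangle]. cbn [fst snd].
  right. do 2 f_equal; ring.
Qed.

Lemma W3_dist_convex (x y z w : R * R) (l : R) : 0 <= l <= 1 ->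
  d3 (W3 x z l) (W3 y w l) <= (1 - l) * d3 x y + l * d3 z w.
Proof.
intros Hl.
pose proof (norm3_scal (1 - l) (sub2 x y)) as H1. pose proof (norm3_scal l (sub2 z w)) as H2.
rewrite Rabs_right in H1, H2 by lra. rewrite !d3_norm3, <- H1, <- H2.
eapply Rle_trans; [| apply norm3_triangle]. unfold sub2, W3. cbn [fst snd].
right. do 2 f_equal; ring.
Qed.

Lemma W3_hyperbolic : W_hyperbolic (R * R) d3 W3.
Proof.
split.
- exact d3_metric.
- intros x y z l Hl. pose proof (W3_dist_convex z x z y l Hl) as H.
  replace (W3 z z l) with z in H; trivial.
  unfold W3. destruct z. cbn [fst snd]. f_equal; ring.
- intros x y l m _ _. unfold d3. rewrite <- norm3_scal. unfold W3. cbn [fst snd].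
  rewrite <- norm3_opp. cbn [fst snd]. do 2 f_equal; ring.
- intros x y l _. unfold W3. f_equal; ring.
- intros x y z w l. apply W3_dist_convex.
Qed.

Lemma d3_complete : complete_metric_space (R * R) d3.
Proof.
split; [exact d3_metric |].
intros u Hu.
destruct (R_complete (fun n => fst (u n))) as [s Hs].
{ intros eps He. destruct (Hu eps He) as [N HN]. exists N. intros n m Hn Hm.
  eapply Rle_lt_trans; [| exact (HN n m Hn Hm)].
  exact (norm3_ge_fst (sub2 (u n) (u m))). }
destruct (R_complete (fun n => snd (u n))) as [t Ht].
{ intros eps He. destruct (Hu eps He) as [N HN]. exists N. intros n m Hn Hm.
  eapply Rle_lt_trans; [| exact (HN n m Hn Hm)].
  exact (norm3_ge_snd (sub2 (u n) (u m))). }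
exists (s, t). intros eps He.
destruct (Hs (eps / 2)) as [N1 HN1]; [lra |]. destruct (Ht (eps / 2)) as [N2 HN2]; [lra |].
exists (Nat.max N1 N2). intros n Hn.
specialize (HN1 n ltac:(lia)). specialize (HN2 n ltac:(lia)).
eapply Rle_lt_trans; [apply norm3_le_sum |]. cbn [fst snd].
unfold Rdist in *. lra.
Qed.

(** * The duality mapping of the 3-norm *)

(** The value at [p] of the normalized duality mapping at [q], that is, of the
    derivative of half the squared norm. For [q = 0] the division by zero is
    harmless since the numerator vanishes. *)
Definition dual3 (p q : R * R) : R :=
  (fst p * (fst q * Rabs (fst q)) + snd p * (snd q * Rabs (snd q))) / norm3 q.

Lemma dual3_self (q : R * R) : dual3 q q = norm3 q ^ 2.
Proof.
unfold dual3. destruct (Req_dec (norm3 q) 0) as [E | H].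
- rewrite E. destruct (norm3_eq0 q E) as [-> ->]. unfold Rdiv. ring.
- transitivity (norm3 q ^ 3 / norm3 q); [| now field].
  rewrite norm3_cube. f_equal.
  transitivity (fst q ^ 2 * Rabs (fst q) + snd q ^ 2 * Rabs (snd q)); [ring |].
  rewrite <- (pow2_abs (fst q)), <- (pow2_abs (snd q)). ring.
Qed.

Lemma mul_le_abs (a b : R) : a * b <= Rabs a * Rabs b.
Proof. rewrite <- Rabs_mult. apply Rle_abs. Qed.

Lemma dual3_le (p q : R * R) : dual3 p q <= norm3 p * norm3 q.
Proof.
unfold dual3. destruct (norm3_nonneg q) as [H | <-].
- apply (Rmult_le_reg_r (norm3 q)); trivial.
  unfold Rdiv. rewrite Rmult_assoc, Rinv_l, Rmult_1_r by lra.
  pose proof (norm3_holder p q) as Ho.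
  pose proof (mul_le_abs (fst p) (fst q * Rabs (fst q))) as H1.
  pose proof (mul_le_abs (snd p) (snd q * Rabs (snd q))) as H2.
  rewrite !Rabs_mult, !Rabs_Rabsolu in H1, H2. lra.
- unfold Rdiv. rewrite Rinv_0. lra.
Qed.

Lemma dual3_opp_l (p q : R * R) : dual3 (- fst p, - snd p) q = - dual3 p q.
Proof. unfold dual3, Rdiv. cbn [fst snd]. ring. Qed.

Lemma dual3_opp_r (p q : R * R) : dual3 p (- fst q, - snd q) = - dual3 p q.
Proof. unfold dual3, Rdiv. rewrite norm3_opp. cbn [fst snd]. rewrite !Rabs_Ropp. ring. Qed.

Lemma dual3_add (p q r : R * R) :
  dual3 (fst p + fst q, snd p + snd q) r = dual3 p r + dual3 q r.
Proof. unfold dual3, Rdiv. cbn [fst snd]. ring. Qed.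

Lemma dual3_scal (k : R) (p r : R * R) : dual3 (k * fst p, k * snd p) r = k * dual3 p r.
Proof. unfold dual3, Rdiv. cbn [fst snd]. ring. Qed.

Lemma norm3_subgradient (a b : R * R) :
  norm3 (fst a + fst b, snd a + snd b) ^ 2
  <= norm3 a ^ 2 + 2 * dual3 b (fst a + fst b, snd a + snd b).
Proof.
set (w := (fst a + fst b, snd a + snd b)).
pose proof (dual3_add a b w) as E. fold w in E. rewrite dual3_self in E.
pose proof (dual3_le a w). pose proof (pow2_ge_0 (norm3 a - norm3 w)). lra.
Qed.

Lemma signed_square_lipschitz (s t : R) :
  Rabs (s * Rabs s - t * Rabs t) <= (Rabs s + Rabs t) * Rabs (s - t).
Proof.
unfold Rabs. destruct (Rcase_abs s), (Rcase_abs t), (Rcase_abs (s - t)), (Rcase_abs _); nra.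
Qed.

Lemma norm3_lipschitz (p q : R * R) : Rabs (norm3 p - norm3 q) <= norm3 (sub2 p q).
Proof.
pose proof (metric_triangle _ _ d3_metric p q (0, 0)) as H1.
pose proof (metric_triangle _ _ d3_metric q p (0, 0)) as H2.
rewrite (metric_sym _ _ d3_metric q p) in H2.
assert (E : forall u, d3 u (0, 0) = norm3 u).
{ intros [s t]. unfold d3. cbn [fst snd]. now rewrite !Rminus_0_r. }
rewrite !E in *. unfold sub2. fold (d3 p q). apply Rabs_le. lra.
Qed.

(** A coordinate of the duality mapping: [s] and [t] are coordinates of two
    vectors with norms [m] and [n], and [e] bounds the norm of their difference. *)
Lemma duality_coordinate_lipschitz (s t m n e : R) :
  Rabs s <= m -> Rabs t <= n -> n <= m ->
  Rabs (m - n) <= e -> Rabs (s - t) <= e ->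
  Rabs (s * Rabs s / m - t * Rabs t / n) <= 3 * e.
Proof.
intros Hs Ht Hnm Hmn Hst.
pose proof (Rabs_pos s). pose proof (Rabs_pos t).
destruct (Req_dec n 0) as [-> | Hn].
- assert (Rabs t = 0) by lra. assert (E : t * Rabs t / 0 = 0) by (rewrite H1; unfold Rdiv; ring).
  rewrite E, Rminus_0_r.
  destruct (Req_dec m 0) as [-> | Hm].
  + assert (E' : Rabs s = 0) by lra. rewrite E'. unfold Rdiv. rewrite Rmult_0_r, Rmult_0_l, Rabs_R0.
    pose proof (Rabs_pos (s - t)). lra.
  + rewrite Rminus_0_r, Rabs_right in Hmn by lra.
    unfold Rdiv. rewrite !Rabs_mult, Rabs_Rabsolu, (Rabs_right (/ m))
      by (left; apply Rinv_0_lt_compat; lra).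
    apply (Rmult_le_reg_r m); [lra |]. rewrite Rmult_assoc, Rinv_l by lra. nra.
- assert (0 < n) by lra. apply (Rmult_le_reg_r m); [lra |].
  rewrite <- (Rabs_right m) at 2 by lra. rewrite <- Rabs_mult.
  (* Since [n <= m], multiplying by [m] leaves only the quotient [t * Rabs t / n], of
   absolute value at most [n]. *)
  replace ((s * Rabs s / m - t * Rabs t / n) * m) with
    ((s * Rabs s - t * Rabs t) + (t * Rabs t / n) * (n - m)) by (field; lra).
  eapply Rle_trans; [apply Rabs_triang |].
  pose proof (signed_square_lipschitz s t) as H2.
  assert (H3 : Rabs (t * Rabs t / n * (n - m)) <= n * e).
  { rewrite Rabs_mult, (Rabs_minus_sym n m). apply Rmult_le_compat; try apply Rabs_pos; trivial.
    unfold Rdiv. rewrite !Rabs_mult, Rabs_Rabsolu, (Rabs_right (/ n))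
      by (left; apply Rinv_0_lt_compat; lra).
    apply (Rmult_le_reg_r n); [lra |]. rewrite Rmult_assoc, Rinv_l by lra. nra. }
  pose proof (Rabs_pos (s - t)).
  assert ((Rabs s + Rabs t) * Rabs (s - t) <= (m + n) * e) by (apply Rmult_le_compat; lra).
  nra.
Qed.

Lemma dual3_lipschitz (x p q : R * R) :
  Rabs (dual3 x p - dual3 x q) <= 6 * norm3 (sub2 p q) * norm3 x.
Proof.
assert (K : forall p q, norm3 q <= norm3 p ->
  Rabs (dual3 x p - dual3 x q) <= 6 * norm3 (sub2 p q) * norm3 x).
{ clear p q. intros p q Hpq.
  pose proof (norm3_ge_fst (sub2 p q)) as D1. pose proof (norm3_ge_snd (sub2 p q)) as D2.
  cbn [sub2 fst snd] in D1, D2. pose proof (norm3_lipschitz p q) as D.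
  pose proof (duality_coordinate_lipschitz _ _ _ _ _
    (norm3_ge_fst p) (norm3_ge_fst q) Hpq D D1) as C1.
  pose proof (duality_coordinate_lipschitz _ _ _ _ _
    (norm3_ge_snd p) (norm3_ge_snd q) Hpq D D2) as C2.
  replace (dual3 x p - dual3 x q) with
    (fst x * (fst p * Rabs (fst p) / norm3 p - fst q * Rabs (fst q) / norm3 q)
     + snd x * (snd p * Rabs (snd p) / norm3 p - snd q * Rabs (snd q) / norm3 q))
    by (unfold dual3, Rdiv; ring).
  eapply Rle_trans; [apply Rabs_triang |]. rewrite (Rabs_mult (fst x)), (Rabs_mult (snd x)).
  apply Rle_trans with
    (norm3 x * (3 * norm3 (sub2 p q)) + norm3 x * (3 * norm3 (sub2 p q))); [| lra].
  apply Rplus_le_compat; apply Rmult_le_compat; try apply Rabs_pos; trivial.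
  - apply norm3_ge_fst.
  - apply norm3_ge_snd. }
destruct (Rle_or_lt (norm3 q) (norm3 p)) as [H | H]; [now apply K |].
rewrite Rabs_minus_sym. change (norm3 (sub2 p q)) with (d3 p q).
rewrite (metric_sym _ _ d3_metric). apply K. lra.
Qed.

(** The pairing of the vectors from [snd a] to [fst a] and from [snd b] to
    [fst b]; reversing both orientations does not change the value. *)
Definition pi3 (a b : (R * R) * (R * R)) : R :=
  dual3 (sub2 (fst a) (snd a)) (sub2 (fst b) (snd b)).

Lemma sub2_opp (p q : R * R) : sub2 p q = (- fst (sub2 q p), - snd (sub2 q p)).
Proof. unfold sub2. cbn [fst snd]. f_equal; ring. Qed.

Lemma pi3_uniformly_smooth : uniformly_smooth_hyperbolic (R * R) d3 W3 pi3.
Proof.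
unfold pi3. split.
- split; cbn [fst snd].
  + exact W3_hyperbolic.
  + intros x y. apply dual3_self.
  + intros x y u v. split.
    * now rewrite (sub2_opp y x), dual3_opp_l, Ropp_involutive.
    * now rewrite (sub2_opp v u), dual3_opp_r, Ropp_involutive.
  + intros x y z u v. rewrite <- dual3_add. f_equal. unfold sub2. cbn [fst snd].
    f_equal; ring.
  + intros x y u v. apply dual3_le.
  + intros x y z l Hl.
    set (a := ((1 - l) * fst (sub2 x z), (1 - l) * snd (sub2 x z))).
    set (b := (l * fst (sub2 y z), l * snd (sub2 y z))).
    assert (E : sub2 (W3 x y l) z = (fst a + fst b, snd a + snd b)).
    { unfold a, b, sub2, W3. cbn [fst snd]. f_equal; ring. }
    rewrite d3_norm3, E. eapply Rle_trans; [apply norm3_subgradient |].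
    unfold a at 1. rewrite norm3_scal, Rpow_mult_distr, pow2_abs.
    unfold b at 1. rewrite dual3_scal. rewrite <- d3_norm3. lra.
- exists (fun _ eps => eps / 6). split; [intros; lra |]. cbn [fst snd].
  intros r eps a u v x y Hr He _ _ Huv.
  eapply Rle_trans; [apply dual3_lipschitz |]. rewrite <- (d3_norm3 x y).
  apply Rmult_le_compat_r; [apply (metric_nonneg _ _ d3_metric) |].
  replace (norm3 (sub2 (sub2 u a) (sub2 v a))) with (d3 u v); [lra |].
  rewrite d3_norm3. f_equal. unfold sub2. cbn [fst snd]. f_equal; ring.
Qed.

(** * Convexity of the 3-norm *)

Lemma clarkson_scalar (s t : R) :
  Rabs ((s + t) / 2) ^ 3 + Rabs ((s - t) / 2) ^ 3 <= (Rabs s ^ 3 + Rabs t ^ 3) / 2.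
Proof.
(* In terms of half the sum [a] and half the difference [b], the claim reduces to
   [0 <= b <= a] by symmetry. *)
set (a := (s + t) / 2). set (b := (s - t) / 2).
replace s with (a + b) by (unfold a, b; field). replace t with (a - b) by (unfold a, b; field).
clearbody a b. clear s t.
assert (K : forall a b, 0 <= b <= a ->
  a ^ 3 + b ^ 3 <= (Rabs (a + b) ^ 3 + Rabs (a - b) ^ 3) / 2).
{ intros c d H. rewrite !Rabs_right by lra.
  assert (0 <= d ^ 2 * (3 * c - d)) by (apply Rmult_le_pos; nra). lra. }
assert (K' : forall a b, 0 <= a -> 0 <= b ->
  a ^ 3 + b ^ 3 <= (Rabs (a + b) ^ 3 + Rabs (a - b) ^ 3) / 2).
{ intros c d Hc Hd. destruct (Rle_or_lt d c); [apply K; lra |].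
  rewrite (Rplus_comm (c ^ 3)), (Rplus_comm c d), (Rabs_minus_sym c d). apply K; lra. }
unfold Rabs at 1 2. destruct (Rcase_abs a), (Rcase_abs b).
- rewrite <- (Rabs_Ropp (a + b)), <- (Rabs_Ropp (a - b)).
  replace (- (a + b)) with (- a + - b) by ring. replace (- (a - b)) with (- a - - b) by ring.
  apply K'; lra.
- rewrite <- (Rabs_Ropp (a + b)), <- (Rabs_Ropp (a - b)), (Rplus_comm (Rabs _ ^ 3) (Rabs _ ^ 3)).
  replace (- (a + b)) with (- a - b) by ring. replace (- (a - b)) with (- a + b) by ring.
  apply K'; lra.
- rewrite (Rplus_comm (Rabs _ ^ 3) (Rabs _ ^ 3)).
  replace (a + b) with (a - - b) by ring. replace (a - b) with (a + - b) by ring.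
  apply K'; lra.
- apply K'; lra.
Qed.

Lemma norm3_clarkson (p q : R * R) :
  norm3 ((fst p + fst q) / 2, (snd p + snd q) / 2) ^ 3 + norm3 (sub2 p q) ^ 3 / 8
  <= (norm3 p ^ 3 + norm3 q ^ 3) / 2.
Proof.
rewrite !norm3_cube. cbn [sub2 fst snd].
pose proof (clarkson_scalar (fst p) (fst q)) as H1.
pose proof (clarkson_scalar (snd p) (snd q)) as H2.
assert (E : forall s, Rabs (s / 2) ^ 3 = Rabs s ^ 3 / 8).
{ intros s. unfold Rdiv at 1. rewrite Rabs_mult, (Rabs_right (/ 2)) by lra. field. }
rewrite (E (fst p - fst q)) in H1. rewrite (E (snd p - snd q)) in H2. lra.
Qed.

Lemma d3_cubically_convex : cubically_convex (R * R) d3 W3.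
Proof.
intros r a x y Hr Hx Hy.
pose proof (norm3_clarkson (sub2 x a) (sub2 y a)) as C.
pose proof (Whyp_W1 _ _ _ W3_hyperbolic x y a (1 / 2) ltac:(lra)) as T.
rewrite !(metric_sym _ _ d3_metric a) in T.
replace (norm3 _) with (d3 (W3 x y (1 / 2)) a) in C.
2:{ rewrite d3_norm3. f_equal. unfold sub2, W3. cbn [fst snd]. f_equal; field. }
replace (norm3 (sub2 (sub2 x a) (sub2 y a))) with (d3 x y) in C.
2:{ rewrite d3_norm3. f_equal. unfold sub2. cbn [fst snd]. f_equal; ring. }
rewrite <- !d3_norm3 in C.
pose proof (metric_nonneg _ _ d3_metric (W3 x y (1 / 2)) a) as Hm.
pose proof (metric_nonneg _ _ d3_metric x a). pose proof (metric_nonneg _ _ d3_metric y a).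
set (m := d3 (W3 x y (1 / 2)) a) in *. set (P := d3 x a) in *. set (Q := d3 y a) in *.
set (D := d3 x y) in *.
(* Clarkson's inequality bounds [m ^ 3] by [M ^ 3 + 3 * M * h ^ 2 - D ^ 3 / 8].
   The term in [h] is compensated by the strict convexity of the square, since
   the mean of [P ^ 2] and [Q ^ 2] is [M ^ 2 + h ^ 2]. *)
set (M := (P + Q) / 2). set (h := (P - Q) / 2).
assert (EP : P = M + h) by (unfold M, h; field).
assert (EQ : Q = M - h) by (unfold M, h; field).
assert (HM : m <= M) by (unfold M; lra).
assert (HMr : M <= r) by (unfold M; lra).
assert (HM0 : 0 <= M) by lra.
clearbody M h. rewrite EP, EQ in *. clear P Q EP EQ.
assert (C' : m ^ 3 + D ^ 3 / 8 <= M ^ 3 + 3 * M * h ^ 2) by lra.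
assert (S1 : M ^ 3 - m ^ 3 <= 2 * r * (M ^ 2 - m ^ 2)).
{ replace (M ^ 3 - m ^ 3) with ((M - m) * (M ^ 2 + M * m + m ^ 2)) by ring.
  replace (2 * r * (M ^ 2 - m ^ 2)) with ((M - m) * (2 * r * (M + m))) by ring.
  apply Rmult_le_compat_l; [lra |]. nra. }
assert (S2 : 3 * M * h ^ 2 <= 3 * r * h ^ 2)
  by (apply Rmult_le_compat_r; [apply pow2_ge_0 | lra]).
assert (S3 : 0 <= r * (M ^ 2 - m ^ 2)) by (apply Rmult_le_pos; nra).
apply (Rmult_le_reg_r (24 * r)); [lra |].
rewrite Rmult_minus_distr_r. replace (D ^ 3 / (24 * r) * (24 * r)) with (D ^ 3) by (field; lra).
lra.
Qed.

(** * The product of the half-plane and the plane *)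

Theorem mainTheorem5 :
  complete_metric_space HR3 dHR3 /\
  UCW_hyperbolic HR3 dHR3 WHR3 /\
  exists pi : HR3 * HR3 -> HR3 * HR3 -> R,
    uniformly_smooth_hyperbolic HR3 dHR3 WHR3 pi.
Proof.
split; [| split; [split |]].
- exact (l2dist_complete _ _ _ _ dH_complete d3_complete).
- exact (prodW_hyperbolic _ _ _ _ _ _ (CAT0_W_hyperbolic _ _ _ WH_CAT0) W3_hyperbolic).
- exists (fun _ eps => eps ^ 3 / 384). split; [| intros r s eps _ _ _ _; lra].
  exact (prod_uniformly_convex _ _ _ _ _ _ dH_metric d3_metric
           (CAT0_cubically_convex _ _ _ WH_CAT0) d3_cubically_convex).
- exists (prodpi _ _ (quasilinearization Hplane dH) pi3).
  exact (prod_uniformly_smooth _ _ _ _ _ _ _ _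
           (CAT0_uniformly_smooth _ _ _ WH_CAT0) pi3_uniformly_smooth).
Qed.
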